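(* Let $(\boldsymbol{Z}_k)_{k\in\mathbb{Z}_+}$ be a multitype branching process with random migration (MBPM) such that: (A) the offspring mean matrix $\mathsf{m}$ is primitive with Perron–Frobenius eigenvalue equal to $1$; (B) $h_i(\boldsymbol{z})=o(\|\boldsymbol{z}\|)$ as $\|\boldsymbol{z}\|\to\infty$, for every $i\in\{1,\ldots,p\}$; and such that, for every non-null $\boldsymbol{z}\in\mathbb{Z}_+^p$, $$\mathrm{P}\big(I_{0,i}(\boldsymbol{z})>0,\ \boldsymbol{X}_{0,j,i}\neq\boldsymbol{0},\ i\in A(\boldsymbol{z}),\ j=1,\ldots,z_i+I_{0,i}(\boldsymbol{z})\big)>0,$$ where $A(\boldsymbol{z})=\{i\in\{1,\ldots,p\}: z_i>0\}$. Then $\mathrm{P}(\|\boldsymbol{Z}_n\|\to\infty)>0$ if $$\liminf_{\|\boldsymbol{z}\|\to\infty}\frac{2(\boldsymbol{u}^\top\boldsymbol{z})(\boldsymbol{u}^\top\boldsymbol{h}(\boldsymbol{z}))}{\sigma^2(\boldsymbol{z})}>1,$$ and, for some $0<\delta\le 1$ and $\alpha>0$ and for every $i\in\{1,\ldots,p\}$, as $\|\boldsymbol{z}\|\to\infty$, $$\operatorname{E}\big[|z_i+M_{0,i}(\boldsymbol{z})|^{1+\delta/2}\big]=o\big((\boldsymbol{u}^\top\boldsymbol{z})^{1+\delta}(\boldsymbol{u}^\top\boldsymbol{h}(\boldsymbol{z}))/(\log(\boldsymbol{u}^\top\boldsymbol{z}))^{1+\alpha}\big)$$ and $$\operatorn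ame{E}\big[|M_{0,i}(\boldsymbol{z})-h_i(\boldsymbol{z})|^{2+\delta}\big]=o\big((\boldsymbol{u}^\top\boldsymbol{z})^{1+\delta}(\boldsymbol{u}^\top\boldsymbol{h}(\boldsymbol{z}))/(\log(\boldsymbol{u}^\top\boldsymbol{z}))^{1+\alpha}\big).$$
   Context: Model (MBPM). $\mathbb{N}$ denotes the positive integers and $\mathbb{Z}_+$ the non-negative integers. Fix $p\in\mathbb{N}$ and a probability space on which all random vectors are defined; $\|\cdot\|$ is a norm on $\mathbb{R}^p$. - Offspring: $\boldsymbol{X}_{k,j,i}=(X_{k,j,i,1},\ldots,X_{k,j,i,p})^\top$, $k\in\mathbb{Z}_+$, $j\in\mathbb{N}$, $i\in\{1,\ldots,p\}$, are independent $\mathbb{Z}_+^p$-valued random vectors, identically distributed in $(k,j)$ for each fixed $i$. - Emigration: for each $\boldsymbol{z}\in\mathbb{Z}_+^p$, $\boldsymbol{D}_k(\boldsymbol{z})=(D_{k,1}(\boldsymbol{z}),\ldots,D_{k,p}(\boldsymbol{z}))^\top$, $k\in\mathbb{Z}_+$, are identically distributed $\mathbb{Z}_+^p$-valued random vectors with $D_{k,i}(\boldsymbol{z})=0$ if $z_i=0$ and $D_{k,i}(\boldsymbol{z})\in[1,z_i]$ if $z_i>0$. - Immigration: for each $\boldsymbol{z}\in\mathbb{Z}_+^p$, $\boldsymbol{I}_k(\boldsymbol{z})=(I_{k,1}(\boldsymbol{z}),\ldots,I_{k,p}(\boldsymbol{z}))^\top$, $k\in\mathbb{Z}_+$, are identically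 distributed $\mathbb{N}^p$-valued random vectors. - Migration: for each $\boldsymbol{z}\in\mathbb{Z}_+^p$, $\boldsymbol{M}_k(\boldsymbol{z})=(M_{k,1}(\boldsymbol{z}),\ldots,M_{k,p}(\boldsymbol{z}))^\top$, $k\in\mathbb{Z}_+$, are identically distributed $\mathbb{Z}^p$-valued random vectors with range contained in $[-z_1,\infty)\times\cdots\times[-z_p,\infty)$, where $M_{k,i}(\boldsymbol{z})$ equals $0$ with probability $p_i(\boldsymbol{z})$, $I_{k,i}(\boldsymbol{z})$ with probability $q_i(\boldsymbol{z})$, and $-D_{k,i}(\boldsymbol{z})$ with probability $r_i(\boldsymbol{z})$ (so the law of $M_{k,i}(\boldsymbol{z})$ is the corresponding mixture of the laws of $0$, $I_{k,i}(\boldsymbol{z})$, $-D_{k,i}(\boldsymbol{z})$). Here $p_i(\boldsymbol{z}),q_i(\boldsymbol{z}),r_i(\boldsymbol{z})\in[0,1]$, $p_i(\boldsymbol{z})+q_i(\boldsymbol{z})+r_i(\boldsymbol{z})=1$, and $r_i(\boldsymbol{z})=0$ if $z_i=0$. - $\boldsymbol{Z}_0$ is a $\mathbb{Z}_+^p$-valued random vector, and the random vectors $\boldsymbol{Z}_0,\ \boldsymbol{X}_{k,j,i},\ \boldsymbol{M}_k(\boldsymbol{z})$ ($k\in\mathbb{Z}_+$, $j\in\mathbb{N}$, $1\le i\le p$, $\boldsymbol{z}\in\mathbb{Z}_+^p$) are independent. - The MBPM is defined recursively by $\boldsymbol{Z}_{k+1}=\sum_{i=1}^p\sum_{j=1}^{Z_{k,i}+M_{k,i}(\boldsymbol{Z}_k)}\boldsymbol{X}_{k,j,i}$,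 $k\in\mathbb{Z}_+$ (empty sums are $\boldsymbol 0$). Moments (assumed finite, including second moments of $\boldsymbol{X}_{0,1,i}$ and $\boldsymbol{M}_0(\boldsymbol{z})$): $\boldsymbol{m}_i=\operatorname{E}[\boldsymbol{X}_{0,1,i}]$; $\mathsf{m}=(\boldsymbol{m}_1,\ldots,\boldsymbol{m}_p)\in\mathbb{R}_+^{p\times p}$ (the matrix with columns $\boldsymbol{m}_i$); $\mathsf{\Sigma}_i=\operatorname{Var}[\boldsymbol{X}_{0,1,i}]$ (covariance matrix); $\boldsymbol{h}(\boldsymbol{z})=(h_1(\boldsymbol{z}),\ldots,h_p(\boldsymbol{z}))^\top=\operatorname{E}[\boldsymbol{M}_0(\boldsymbol{z})]$. Under (A), $\boldsymbol{u}=(u_1,\ldots,u_p)^\top$ and $\boldsymbol{v}=(v_1,\ldots,v_p)^\top$ denote the left and right eigenvectors of $\mathsf{m}$ for the eigenvalue $1$ ($\boldsymbol{u}^\top\mathsf{m}=\boldsymbol{u}^\top$, $\mathsf{m}\boldsymbol{v}=\boldsymbol{v}$), with all coordinates positive, normalized by $\sum_{i=1}^p u_i=1$ and $\boldsymbol{u}^\top\boldsymbol{v}=1$. For $\boldsymbol{z}\in\mathbb{Z}_+^p$, $\sigma^2(\boldsymbol{z})=\operatorname{Var}[\boldsymbol{u}^\top\boldsymbol{Z}_{n+1}\mid\boldsymbol{Z}_n=\boldsymbol{z}]=\boldsymbol{u}^\top\Big(\sum_{i=1}^p (z_i+h_i(\boldsymbol{z}))\mathsf{\Sigma}_i+\o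peratorname{Var}[\boldsymbol{M}_0(\boldsymbol{z})]\Big)\boldsymbol{u}$.
   Formalization: The positivity condition is read as also requiring that immigration really occurs, M_{0,i}(z)=I_{0,i}(z)>0 for i in A(z), and the process is assumed not almost surely null, P(Z_n≠0 for some n)>0; without either, the claim fails. *)

(* Defs.v *)
From mathcomp Require Import all_boot all_order all_algebra.
From mathcomp Require Import complex.
From mathcomp Require Import all_classical all_reals all_analysis.
Import Order.TTheory GRing.Theory Num.Theory.
Import numFieldNormedType.Exports.

Set Implicit Arguments.
Unset Strict Implicit.
Unset Printing Implicit Defensive.

Local Open Scope classical_set_scope.
Local Open Scope ring_scope.

Section linear_algebra.
Context {R : realType} {p : nat}.

Definition is_norm (N : 'cV[R]_p -> R) : Prop :=
  [/\ forall x, N x = 0 -> x = 0,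
      forall (a : R) x, N (a *: x) = `|a| * N x &
      forall x y, N (x + y) <= N x + N y].

Definition dot (u x : 'cV[R]_p) : R := (u^T *m x) 0 0.

Definition primitive_mx (A : 'M[R]_p) : Prop :=
  (forall i j, 0 <= A i j) /\
  (exists2 n, (0 < n)%N & forall i j, 0 < (A ^+ n) i j).

(* The Perron-Frobenius eigenvalue of a nonnegative matrix is its spectral
   radius, hence the bound over the complex spectrum. *)
Definition PF_eigenvalue (A : 'M[R]_p) (rho : R) : Prop :=
  eigenvalue A rho /\
  (forall l : complex R,
     eigenvalue (map_mx (real_complex R) A) l -> `|l| <= real_complex R rho).

Definition vec_nat (z : 'cV[nat]_p) : 'cV[R]_p :=
  map_mx (fun n : nat => n%:R) z.

Definition vec_int (z : 'cV[int]_p) : 'cV[R]_p :=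
  map_mx (fun n : int => n%:~R) z.

(* The filter "as ||z|| -> oo, z a nonnegative integer vector". *)
Definition norm_oo (N : 'cV[R]_p -> R) : set_system 'cV[nat]_p :=
  filter_from [set: R] (fun A => [set z | A < N (vec_nat z)]).

Global Instance norm_oo_filter (N : 'cV[R]_p -> R) : Filter (norm_oo N).
Proof.
apply: filter_from_filter; first by exists 0.
move=> A B _ _; exists (Num.max A B) => // z /=.
by rewrite gt_max => /andP[].
Qed.

Canonical norm_oo_filterType (N : 'cV[R]_p -> R) :=
  FilterType (norm_oo N) (norm_oo_filter N).

(* f = o(g) along F for an f that is not known to be finite everywhere:
   f is then finite F-eventually. *)
Definition elittleo (F : set_system 'cV[nat]_p) (f : 'cV[nat]_p -> \bar R)
    (g : 'cV[nat]_p -> R) : Prop :=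
  forall eps : R, 0 < eps ->
    \forall z \near F, (`|f z| <= (eps * `|g z|)%:E)%E.

End linear_algebra.

Section discrete_random_elements.
Context {d : measure_display} {T : measurableType d} {R : realType}.
Variable P : probability T R.

(* The sigma-algebra generated by a random element of a countable set U, which
   carries the sigma-algebra of all its subsets. *)
Definition sigma_of (U : Type) (X : T -> U) : set_system T :=
  preimage_set_system setT X (@discrete_measurable U).

Definition random_element (U : Type) (X : T -> U) : Prop :=
  sigma_of X `<=` measurable.

Definition same_law (U : Type) (X Y : T -> U) : Prop :=
  forall B : set U, P (X @^-1` B) = P (Y @^-1` B).

Definition mutually_independent (K : eqType) (F : K -> set_system T) : Prop :=
  forall (s : seq K) (E : K -> set T), uniq s ->
    (forall l, l \in s -> F l (E l)) ->
    P (\bigcap_(l in [set` s]) E l) = (\prod_(l <- s) P (E l))%E.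

Definition square_integrable (p : nat) (Y : T -> 'cV[R]_p) : Prop :=
  forall l, (fun w => Y w l 0) \in Lfun P 2%:E.

Definition mean_vec (p : nat) (Y : T -> 'cV[R]_p) : 'cV[R]_p :=
  \col_l fine ('E_P[(fun w => Y w l 0)%R])%E.

Definition cov_mx (p : nat) (Y : T -> 'cV[R]_p) : 'M[R]_p :=
  \matrix_(l, l') fine (covariance P (fun w => Y w l 0) (fun w => Y w l' 0)).

End discrete_random_elements.

Section mbpm.
Context {d : measure_display} {T : measurableType d} {R : realType}.
Variables (P : probability T R) (p : nat).

(* X k j i is the offspring vector X_{k,j+1,i}: individuals are numbered from
   0. The three kinds of labels below index Z_0, the X_{k,j,i} and the
   M_k(z). *)
Definition mbpm_label : eqType :=
  (unit + (nat * nat * 'I_p) + (nat * 'cV[nat]_p))%type.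

Definition mbpm_sigma (Z0 : T -> 'cV[nat]_p)
    (X : nat -> nat -> 'I_p -> T -> 'cV[nat]_p)
    (M : nat -> 'cV[nat]_p -> T -> 'cV[int]_p) (l : mbpm_label) :
    set_system T :=
  match l with
  | inl (inl _) => sigma_of Z0
  | inl (inr (k, j, i)) => sigma_of (X k j i)
  | inr (k, z) => sigma_of (M k z)
  end.

(* `|_|%N converts an integer to nat; its argument is nonnegative under
   mbpm_M_range. *)
Fixpoint mbpm (Z0 : T -> 'cV[nat]_p)
    (X : nat -> nat -> 'I_p -> T -> 'cV[nat]_p)
    (M : nat -> 'cV[nat]_p -> T -> 'cV[int]_p) (k : nat) (w : T) :
    'cV[nat]_p :=
  if k is n.+1 then
    let z := mbpm Z0 X M n w in
    \sum_(i < p) \sum_(j < `|((z i 0)%:Z + M n z w i 0)%R|%N) X n j i w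
  else Z0 w.

(* Dm, Im, M: emigration, immigration and migration vectors; pz, qz, rz: the
   probabilities of no migration, immigration and emigration. *)
Record is_mbpm (Z0 : T -> 'cV[nat]_p)
    (X : nat -> nat -> 'I_p -> T -> 'cV[nat]_p)
    (Dm Im : nat -> 'cV[nat]_p -> T -> 'cV[nat]_p)
    (M : nat -> 'cV[nat]_p -> T -> 'cV[int]_p)
    (pz qz rz : 'cV[nat]_p -> 'I_p -> R) : Prop := {
  mbpm_Z0_random : random_element Z0 ;
  mbpm_X_random : forall k j i, random_element (X k j i) ;
  mbpm_D_random : forall k z, random_element (Dm k z) ;
  mbpm_I_random : forall k z, random_element (Im k z) ;
  mbpm_M_random : forall k z, random_element (M k z) ;
  mbpm_X_law : forall k j k' j' i, same_law P (X k j i) (X k' j' i) ;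
  mbpm_D_law : forall k k' z, same_law P (Dm k z) (Dm k' z) ;
  mbpm_I_law : forall k k' z, same_law P (Im k z) (Im k' z) ;
  mbpm_M_law : forall k k' z, same_law P (M k z) (M k' z) ;
  mbpm_D_range : forall k (z : 'cV[nat]_p) w i,
    if z i 0%R == 0%N then Dm k z w i 0%R = 0%N
    else (1 <= Dm k z w i 0%R <= z i 0%R)%N ;
  mbpm_I_range : forall k (z : 'cV[nat]_p) w i, (1 <= Im k z w i 0%R)%N ;
  mbpm_M_range : forall k (z : 'cV[nat]_p) w i, - (z i 0%R)%:Z <= M k z w i 0%R ;
  mbpm_pqr_ge0 : forall z i, [/\ 0 <= pz z i, 0 <= qz z i & 0 <= rz z i] ;
  mbpm_pqr_sum : forall z i, pz z i + qz z i + rz z i = 1 ;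
  mbpm_r0 : forall (z : 'cV[nat]_p) i, z i 0%R = 0%N -> rz z i = 0 ;
  mbpm_mixture : forall k (z : 'cV[nat]_p) i (B : set int),
    P [set w | B (M k z w i 0%R)] =
      ((pz z i)%:E * (\1_B (0 : int))%:E
       + (qz z i)%:E * P [set w | B (Im k z w i 0)%:Z]%R
       + (rz z i)%:E * P [set w | B (- (Dm k z w i 0)%:Z)]%R)%E ;
  mbpm_independent : mutually_independent P (mbpm_sigma Z0 X M)
}.

(* Column i is the mean of X_{0,1,i}. *)
Definition offspring_mean (X : nat -> nat -> 'I_p -> T -> 'cV[nat]_p) :
    'M[R]_p :=
  \matrix_(l, i) mean_vec P (fun w => vec_nat (X 0%N 0%N i w)) l 0.

Definition offspring_cov (X : nat -> nat -> 'I_p -> T -> 'cV[nat]_p)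
    (i : 'I_p) : 'M[R]_p :=
  cov_mx P (fun w => vec_nat (X 0%N 0%N i w)).

Definition migration_mean (M : nat -> 'cV[nat]_p -> T -> 'cV[int]_p)
    (z : 'cV[nat]_p) : 'cV[R]_p :=
  mean_vec P (fun w => vec_int (M 0%N z w)).

Definition migration_cov (M : nat -> 'cV[nat]_p -> T -> 'cV[int]_p)
    (z : 'cV[nat]_p) : 'M[R]_p :=
  cov_mx P (fun w => vec_int (M 0%N z w)).

(* The variance of u^T Z_{n+1} given Z_n = z, in the closed form that makes
   sense also for the z with P (Z_n = z) = 0. *)
Definition sigma2 (X : nat -> nat -> 'I_p -> T -> 'cV[nat]_p)
    (M : nat -> 'cV[nat]_p -> T -> 'cV[int]_p) (u : 'cV[R]_p)
    (z : 'cV[nat]_p) : R :=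
  dot u ((\sum_(i < p)
            ((z i 0%R)%:R + migration_mean M z i 0%R) *: offspring_cov X i
          + migration_cov M z) *m u).

End mbpm.

(* Main.v *)
Require Import Defs.
From HB Require Import structures.
From mathcomp Require Import all_boot all_order all_algebra.
From mathcomp Require Import all_classical all_reals all_analysis.
From mathcomp Require Import measurable_realfun ring lra zify.
Import Order.TTheory GRing.Theory Num.Theory.
Import numFieldNormedType.Exports.
Local Open Scope classical_set_scope.
Local Open Scope ring_scope.

Set Implicit Arguments.
Unset Strict Implicit.
Unset Printing Implicit Defensive.

(* Write x = u^T z and let F(y) = (1 + ln (1 + y))^-alpha, which decreases to 0.
   A second-order Taylor bound for F holds above (1 - e) x with constant
   F''((1 - e) x) ~ F''(x), while below (1 - e) x the bound F <= 1 costs the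
   probability of a large downward deviation of u^T Z_{n+1} from x. As the
   offspring are nonnegative, their sum has an exponential lower tail, so second
   moments of the offspring suffice; the deviations of the migration are handled
   by Markov's inequality. Hence F(u^T Z_n) has a strictly negative drift outside
   a finite set B. From a state with a value of F below its minimum on B, which
   the growth condition makes reachable, the chain avoids B forever with positive
   probability, and summing the drift shows that each state is then visited
   finitely often almost surely. *)

(** * Countable random elements and independence *)

(** The logarithmic shape of F suits both error terms. Write h for u^T h(z). Markov's inequality
    bounds the probability of a migration jump of order x by o(h / (x (log x)^(1 + alpha))), and the
    first-order gain is -F'(x) h, where -F'(x) has just the order 1 / (x (log x)^(1 + alpha)); for a
    negative power of x the gain would be too small. Moreover F''(x) ~ -F'(x) / x with constant 1,
    so the second-order loss is about -F'(x) sigma^2 / (2 x), and the bound 1 in the liminf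
    condition is what lets the gain win; the remaining h^2 is o(x h) by (B). Since h is bounded
    below only through sigma^2, every error has to be proportional to h or to sigma^2; this is why
    the tail of the offspring is bounded by an exponential times their variance. No conditional
    expectation occurs: the states are countable, so events are split over the values of Z_n and the
    state is frozen on each piece. *)

Section countable_random_elements.
Context {d : measure_display} {T : measurableType d}.
Implicit Types (S : set_system T).

Lemma sigma_ofP (U : Type) (W : T -> U) S :
  sigma_of W `<=` S <-> forall B, S (W @^-1` B).
Proof.
split=> [WS B|WS _ [B _ <-]]; last by rewrite setTI.
by apply: WS; exists B => //; rewrite setTI.
Qed.

Lemma sigma_of_preimage (U : Type) (W : T -> U) B : sigma_of W (W @^-1` B).
Proof. by exists B => //; rewrite setTI. Qed.

Lemma sigma_of_comp (U V : Type) (W : T -> U) (g : U -> V) :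
  sigma_of (g \o W) `<=` sigma_of W.
Proof. by apply/sigma_ofP => B; exact: (sigma_of_preimage W (g @^-1` B)). Qed.

Lemma sigma_ofT (U : Type) (W : T -> U) : sigma_of W setT.
Proof. exact: (sigma_of_preimage W setT). Qed.

Lemma sigma_ofI (U : Type) (W : T -> U) : setI_closed (sigma_of W).
Proof.
move=> _ _ [B _ <-] [C _ <-]; rewrite !setTI.
exact: (sigma_of_preimage W (B `&` C)).
Qed.

Section closure.
Variables (S : set_system T) (sS : sigma_algebra setT S).

Lemma sigma_countable_bigcup (I : countType) (F : I -> set T) (D : set I) :
  (forall i, S (F i)) -> S (\bigcup_(i in D) F i).
Proof.
case: sS => S0 _ Su SF.
(* Closure holds for unions over [nat]; numbers that code no element of [I], and elements outside
   [D], are padded with [set0]. *)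
rewrite (_ : \bigcup_(i in D) F i = \bigcup_k
    (if @pickle_inv I k is Some i then if `[< D i >] then F i else set0
     else set0)).
  apply: Su => k; case: (pickle_inv k) => [i|]//; by case: ifP.
apply/seteqP; split=> [w [i Di Fiw]|w [k _]].
  by exists (pickle i) => //; rewrite pickleK_inv; case: asboolP.
case: (pickle_inv k) => [i|]//; case: asboolP => // Di Fiw.
by exists i.
Qed.

Lemma sigma_setC (A : set T) : S A -> S (~` A).
Proof. by case: sS => _ SC _ /SC; rewrite setTD. Qed.

Lemma sigma_setT : S setT.
Proof. by case: sS => S0 SC _; have := SC _ S0; rewrite setD0. Qed.

Lemma sigma_countable_bigcap (I : countType) (F : I -> set T) (D : set I) :
  (forall i, S (F i)) -> S (\bigcap_(i in D) F i).
Proof.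
move=> SF; rewrite -[X in S X]setCK setC_bigcap; apply: sigma_setC.
by apply: sigma_countable_bigcup => i; exact: sigma_setC.
Qed.

Lemma sigma_setI (A B : set T) : S A -> S B -> S (A `&` B).
Proof.
move=> SA SB; rewrite (_ : _ `&` _ = \bigcap_b (if b then A else B)).
  by apply: sigma_countable_bigcap => -[].
by apply/seteqP; split=> [w [Aw Bw] []|w ABw]//; split;
  [exact: (ABw true)|exact: (ABw false)].
Qed.

Lemma sigma_setU (A B : set T) : S A -> S B -> S (A `|` B).
Proof.
move=> SA SB; rewrite -[X in S X]setCK setCU; apply/sigma_setC/sigma_setI;
exact: sigma_setC.
Qed.

Lemma sigma_of_points (U : countType) (W : T -> U) :
  (forall a, S (W @^-1` [set a])) -> sigma_of W `<=` S.
Proof.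
move=> SW; apply/sigma_ofP => B.
rewrite (_ : W @^-1` B = \bigcup_(a in B) W @^-1` [set a]).
  exact: sigma_countable_bigcup.
by apply/seteqP; split=> [w Bw|w [a Ba /= ->]]//; exists (W w).
Qed.

Lemma sigma_of_freeze (U V : countType) (W : T -> U) (H : U -> T -> V) :
  sigma_of W `<=` S -> (forall a, sigma_of (H a) `<=` S) ->
  sigma_of (fun w => H (W w) w) `<=` S.
Proof.
move=> /sigma_ofP SW SH; apply: sigma_of_points => b.
rewrite (_ : _ @^-1` _ =
  \bigcup_a (W @^-1` [set a] `&` H a @^-1` [set b])).
  apply: sigma_countable_bigcup => a; apply: sigma_setI => //.
  by move/sigma_ofP : (SH a); exact.
apply/seteqP; split=> [w /= Hw|w [a _ [/= <- //]]].
by exists (W w).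
Qed.

Lemma sigma_of_sum (K : eqType) (p : nat) (W : K -> T -> 'cV[nat]_p)
    (s : seq K) :
  (forall k, k \in s -> sigma_of (W k) `<=` S) ->
  sigma_of (fun w => \sum_(k <- s) W k w) `<=` S.
Proof.
elim: s => [_|l s IH SW].
  rewrite (_ : (fun _ => _) = cst 0); last by apply/funext => w; rewrite big_nil.
  apply/sigma_ofP => B; rewrite preimage_cst; case: ifP => _.
    exact: sigma_setT.
  by case: sS.
rewrite (_ : (fun w => _) = (fun w => W l w + \sum_(k <- s) W k w)); last first.
  by apply/funext => w; rewrite big_cons.
apply: (@sigma_of_freeze 'cV[nat]_p 'cV[nat]_p (W l) (fun a w => a + \sum_(k <- s) W k w)).
  by apply: SW; rewrite mem_head.
move=> a; apply: subset_trans (IH _); last first.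
  by move=> k ks; apply: SW; rewrite inE ks orbT.
exact: (@sigma_of_comp _ _ (fun w => \sum_(k <- s) W k w) (fun b => a + b)).
Qed.

End closure.
End countable_random_elements.

(** * Integration over the values of a countable random element *)

Section countable_integrals.
Context {d : measure_display} {T : measurableType d} {R : realType}.
Variable P : probability T R.
Local Open Scope ereal_scope.

Let sM : sigma_algebra setT (@measurable _ T).
Proof. exact: sigma_algebra_measurable. Qed.

Lemma integral_probability_cst (r : R) : \int[P]_w r%:E = r%:E.
Proof.
by rewrite integral_cst//; have /= -> := @probability_setT _ _ _ P; rewrite mule1.
Qed.

Lemma random_element_preimage (U : Type) (W : T -> U) B :
  random_element W -> measurable (W @^-1` B).
Proof. by move=> /sigma_ofP. Qed.

Lemma measurable_fun_countable (U : countType) (W : T -> U)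
    d' (V : measurableType d') (psi : U -> V) (D : set T) :
  random_element W -> measurable_fun D (psi \o W).
Proof.
move=> rW mD B mB; apply: measurableI => //.
exact: (random_element_preimage (psi @^-1` B)).
Qed.

(** This does the work of conditioning on W. A number that codes no element of U has an empty piece,
    hence the default 0. *)
Lemma ge0_integral_countable_partition (U : countType) (W : T -> U) (D : set T)
    (f : T -> \bar R) :
  random_element W -> measurable D -> (forall w, 0 <= f w) ->
  measurable_fun setT f ->
  \int[P]_(w in D) f w = \sum_(k <oo)
    (if @pickle_inv U k is Some a then
       \int[P]_(w in D `&` W @^-1` [set a]) f w else 0).
Proof.
move=> rW mD f0 mf.
pose F k := D `&` W @^-1` [set a | pickle a = k].
have DF : D = \bigcup_k F k.
  apply/seteqP; split=> [w Dw|w [k _ []]]//.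
  by exists (pickle (W w)).
rewrite [in LHS]DF ge0_integral_bigcup//; first last.
- by apply/trivIsetP => i j _ _ /eqP ij; rewrite -subset0 => w [[_ /= Wi] [_ /= Wj]];
    apply: ij; rewrite -Wi -Wj.
- exact: measurable_funTS.
- by move=> k; apply: measurableI => //; exact: random_element_preimage.
apply: eq_eseriesr => k _; case E : (pickle_inv k) => [a|].
  congr (\int[P]_(_ in D `&` W @^-1` _) _).
  apply/seteqP; split=> [b /= bk|b /= ->].
    by apply/Some_inj; rewrite -E -bk pickleK_inv.
  by have := @pickle_invK U k; rewrite /ocancel /= E.
rewrite (_ : F k = set0) ?integral_set0// -subset0 => w [_ /= Wk].
by move: E; rewrite -Wk pickleK_inv.
Qed.

Lemma ge0_integral_countable (U : countType) (W : T -> U) (D : set T) (psi : U -> \bar R) :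
  random_element W -> measurable D -> (forall a, 0 <= psi a) ->
  \int[P]_(w in D) psi (W w) = \sum_(k <oo)
    (if @pickle_inv U k is Some a then
       psi a * P (D `&` W @^-1` [set a]) else 0).
Proof.
move=> rW mD psi0; rewrite (ge0_integral_countable_partition rW)//; last first.
  exact: (measurable_fun_countable psi).
apply: eq_eseriesr => k _; case: (pickle_inv k) => [a|]//.
have mDa : measurable (D `&` W @^-1` [set a]).
  by apply: measurableI => //; exact: random_element_preimage.
rewrite -integral_cst//; apply: eq_integral => w.
by rewrite inE => -[_ /= ->].
Qed.

Lemma same_law_integral (U : countType) (W W' : T -> U) (psi : U -> \bar R) :
  random_element W -> random_element W' -> same_law P W W' ->
  (forall a, 0 <= psi a) -> \int[P]_w psi (W w) = \int[P]_w psi (W' w).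
Proof.
move=> rW rW' WW' psi0; rewrite (ge0_integral_countable rW)//.
rewrite (ge0_integral_countable rW')//; apply: eq_eseriesr => k _.
by case: (pickle_inv k) => // a; rewrite !setTI WW'.
Qed.

Lemma integral_independent (U : countType) (W : T -> U) (D : set T) (psi : U -> \bar R) :
  random_element W -> measurable D -> (forall a, 0 <= psi a) ->
  (forall B, P (D `&` W @^-1` B) = P D * P (W @^-1` B)) ->
  \int[P]_(w in D) psi (W w) = P D * \int[P]_w psi (W w).
Proof.
move=> rW mD psi0 PD; rewrite !(ge0_integral_countable rW)//.
rewrite -[P D in RHS]fineK ?fin_num_measure// -nneseriesZl; last first.
  by move=> k _; case: (pickle_inv k) => // a; rewrite mule_ge0.
apply: eq_eseriesr => k _; case: (pickle_inv k) => [a|]; last by rewrite mule0.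
by rewrite PD setTI fineK ?fin_num_measure// muleCA.
Qed.

Definition independent_elements (U V : Type) (W : T -> U) (W' : T -> V) :=
  forall A B, P (W @^-1` A `&` W' @^-1` B) = P (W @^-1` A) * P (W' @^-1` B).

(** A discrete Fubini theorem: the second variable may be selected by the value of the first, and
    only the independence of W from each single [W' a] enters. *)
Lemma integral_freeze (U V : countType) (W : T -> U) (W' : U -> T -> V)
    (phi : U -> V -> \bar R) :
  random_element W -> (forall a, random_element (W' a)) ->
  (forall a b, 0 <= phi a b) ->
  (forall a, independent_elements W (W' a)) ->
  \int[P]_w phi (W w) (W' (W w) w) =
  \int[P]_w \int[P]_w' phi (W w) (W' (W w) w').
Proof.
move=> rW rW' phi0 ind.
rewrite (ge0_integral_countable_partition rW)//; last first.
  move=> mT B mB; rewrite setTI.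
  have rWW' : random_element (fun w => phi (W w) (W' (W w) w)).
    apply/sigma_ofP => C.
    rewrite (_ : _ @^-1` C = \bigcup_a (W @^-1` [set a] `&`
       W' a @^-1` (phi a @^-1` C))).
      apply: (sigma_countable_bigcup sM) => a; apply: measurableI;
      exact: random_element_preimage.
    by apply/seteqP; split=> [w /= Cw|w [a _ [/= ->]]]//; exists (W w).
  exact: random_element_preimage.
rewrite [RHS](@ge0_integral_countable _ W setT
  (fun a => \int[P]_w' phi a (W' a w')))//; last first.
  by move=> a; exact: integral_ge0.
apply: eq_eseriesr => k _; case: (pickle_inv k) => [a|]//.
rewrite setTI muleC -integral_independent//.
- by apply: eq_integral => w; rewrite inE => /= ->.
- exact: random_element_preimage.
- by move=> B; exact: (ind a [set a] B).
Qed.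

End countable_integrals.

(** * Independence of sigma-algebras generated by disjoint families of labels *)

Section independence.
Context {d : measure_display} {T : measurableType d} {R : realType}.
Variable P : probability T R.

(** Both sides are finite measures in A that agree on the pi-system G, so uniqueness of measures
    extends the equality to the generated sigma-algebra. *)
Lemma independent_generated (G : set_system T) (B : set T) :
  setI_closed G -> G `<=` measurable -> G setT -> measurable B ->
  (forall A, G A -> P (A `&` B) = P A * P B)%E ->
  forall A, <<s G >> A -> P (A `&` B) = (P A * P B)%E.
Proof.
move=> GI Gm GT mB GB A sA.
have PBE : (fine (P B))%:E = P B by rewrite fineK ?fin_num_measure.
have PB0 : (0 <= fine (P B))%R by rewrite fine_ge0.
pose m1 := mrestr P mB; pose m2 := mscale (NngNum PB0) P.
suff : m1 A = m2 A by rewrite /m1 /m2 /mrestr /mscale /= PBE muleC.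
apply: (@g_sigma_algebra_measure_unique _ R T G Gm (fun=> setT)) => //.
- by rewrite bigcup_const.
- move=> C GC; change (P (C `&` B) = (fine (P B))%:E * P C)%E.
  by rewrite PBE muleC GB.
- move=> n; change (P (setT `&` B) < +oo)%E.
  by rewrite setTI (le_lt_trans (probability_le1 _ _))// ltry.
Qed.

Variables (K : eqType) (F : K -> set_system T).
Hypothesis indF : mutually_independent P F.
Hypothesis FI : forall l, setI_closed (F l).
Hypothesis FT : forall l, F l setT.
Hypothesis Fm : forall l, F l `<=` measurable.

Lemma bigcap_eq_seq (s : seq K) (E : K -> set T) :
  \bigcap_(l in [set` s]) E l = \big[setI/setT]_(l <- s) E l.
Proof.
elim: s => [|k s IH]; first by rewrite big_nil; apply/seteqP; split.
rewrite big_cons -IH; apply/seteqP; split=> [w ks|w [kw sw] l /=].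
  split; first by apply: ks; rewrite /= inE eqxx.
  by move=> l /= ls; apply: ks; rewrite /= inE ls orbT.
by rewrite inE => /predU1P[->//|/sw].
Qed.

(* The finite intersections form a pi-system generating the sigma-algebra of
   all the labels in A. *)
Definition cylinders (A : set K) : set_system T :=
  [set C | exists s E, [/\ uniq s, (forall l, l \in s -> A l),
     (forall l, l \in s -> F l (E l)) & C = \bigcap_(l in [set` s]) E l]].

Lemma cylinders_measurable A : cylinders A `<=` measurable.
Proof.
move=> _ [s [E [us sA FE ->]]]; rewrite bigcap_eq_seq.
rewrite big_seq; apply: big_ind => // [|l ls]; first exact: measurableI.
by apply: (Fm (l := l)); exact: FE.
Qed.

Lemma cylindersT A : cylinders A setT.
Proof. by exists [::], (fun=> setT); split => //; rewrite bigcap_eq_seq big_nil. Qed.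

Lemma cylinders1 A l : A l -> F l `<=` cylinders A.
Proof.
move=> Al C FC; exists [:: l], (fun=> C); split=> //.
- by move=> k; rewrite inE => /eqP ->.
- by move=> k; rewrite inE => /eqP ->.
- by rewrite bigcap_eq_seq big_seq1.
Qed.

Lemma cylindersI A : setI_closed (cylinders A).
Proof.
move=> _ _ [s [E [us sA FE ->]]] [t [E' [ut tA FE' ->]]].
(* A label of both lists receives the intersection of its two events; a label of one list only is
   completed by [setT]. *)
exists (undup (s ++ t)), (fun l => (if l \in s then E l else setT) `&`
  (if l \in t then E' l else setT)); split.
- exact: undup_uniq.
- by move=> l; rewrite mem_undup mem_cat => /orP[/sA|/tA].
- by move=> l _; apply: FI; case: ifPn => // ?; [exact: FE|exact: FE'].
- apply/seteqP; split=> [w [sw tw] l /= _|w stw].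
    by split; case: ifPn => // ?; [exact: sw|exact: tw].
  split=> l /= lst; have /= := stw l; rewrite mem_undup mem_cat lst ?orbT;
    by move=> /(_ isT)[].
Qed.

Lemma cylinders_independent A B : A `&` B = set0 ->
  forall C D, cylinders A C -> cylinders B D ->
  P (C `&` D) = (P C * P D)%E.
Proof.
move=> AB0 _ _ [s [E [us sA FE ->]]] [t [E' [ut tB FE' ->]]].
have st l : l \in t -> l \notin s.
  move=> lt; apply/negP => ls; suff : set0 l by [].
  by rewrite -AB0; split; [exact: sA|exact: tB].
pose E2 l := if l \in s then E l else E' l.
have -> : \bigcap_(l in [set` s]) E l `&` \bigcap_(l in [set` t]) E' l =
    \bigcap_(l in [set` s ++ t]) E2 l.
  apply/seteqP; split=> [w [sw tw] l /=|w stw].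
    rewrite mem_cat /E2; case: ifPn => //= ls; first by move=> _; exact: sw.
    exact: tw.
  split=> l /= ls; have /= := stw l; rewrite /E2 mem_cat ls ?orbT => /(_ isT)//.
  by rewrite (negbTE (st _ ls)).
rewrite !indF//; last first.
- move=> l; rewrite mem_cat /E2; case: ifPn => [/FE//|_ /= /FE']//.
- rewrite cat_uniq us ut andbT /=; apply/hasPn => l; exact: st.
rewrite big_cat /=; congr (_ * _)%E; apply: eq_big_seq => l ls; rewrite /E2.
  by rewrite ls.
by rewrite (negbTE (st _ ls)).
Qed.

(** The pi-system argument is run twice: once in C with D fixed, which leaves C a cylinder, then in
    D with that cylinder fixed. *)
Lemma independent_labels A B : A `&` B = set0 ->
  forall C D, <<s cylinders A >> C -> <<s cylinders B >> D ->
  P (C `&` D) = (P C * P D)%E.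
Proof.
move=> AB0 C D sC sD.
have sm G : <<s cylinders G >> `<=` measurable.
  apply: smallest_sub; first exact: sigma_algebra_measurable.
  exact: cylinders_measurable.
apply: (independent_generated (@cylindersI A) (@cylinders_measurable A)
  (@cylindersT A) (sm _ _ sD) _ sC).
move=> {sC} {}C cC; rewrite setIC muleC.
apply: (independent_generated (@cylindersI B) (@cylinders_measurable B)
  (@cylindersT B) (@cylinders_measurable A _ cC) _ sD).
by move=> {sD} {}D cD; rewrite setIC muleC; exact: cylinders_independent cC cD.
Qed.

End independence.

(** * Sums of independent random elements *)

Section independent_sums.
Context {d : measure_display} {T : measurableType d} {R : realType}.
Variables (P : probability T R) (K : eqType) (p : nat).
Local Notation U := 'cV[nat]_p.
Variables (W : K -> T -> U) (y : U -> R) (mu tau : K -> R).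
Local Notation Sum s w := (\sum_(k <- s) W k w)%R.
Hypothesis rW : forall l, random_element (W l).
Hypothesis indW : forall l (s : seq K), uniq (l :: s) ->
  independent_elements P (fun w => Sum s w) (W l).
Hypothesis y0 : y 0 = 0.
Hypothesis yD : forall a b, y (a + b) = y a + y b.
Hypothesis y_ge0 : forall a, 0 <= y a.
Hypothesis W_mean : forall l, (\int[P]_w (y (W l w))%:E)%E = (mu l)%:E.
Hypothesis W_var : forall l c, (\int[P]_w ((y (W l w) - c) ^+ 2)%:E)%E
  = (tau l + (mu l - c) ^+ 2)%:E.

Let sM : sigma_algebra setT (@measurable _ T).
Proof. exact: sigma_algebra_measurable. Qed.

Lemma random_element_sum (s : seq K) :
  random_element (fun w => Sum s w).
Proof. by apply: (sigma_of_sum sM) => k _; exact: rW. Qed.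

Lemma integral_sum_cons (phi : R -> \bar R) l (s : seq K) :
  (forall r, 0 <= phi r)%E -> uniq (l :: s) ->
  (\int[P]_w phi (y (Sum (l :: s) w)) =
   \int[P]_w \int[P]_w' phi (y (Sum s w) + y (W l w'))%R)%E.
Proof.
move=> phi0 ls; have := @integral_freeze _ _ _ P U U
  (fun w => Sum s w) (fun=> W l) (fun a b => phi (y a + y b)).
move=> <- //; last 2 first.
- exact: random_element_sum.
- by move=> _; exact: indW.
by apply: eq_integral => w _; rewrite big_cons yD addrC.
Qed.

Let msum (s : seq K) (phi : R -> \bar R) :
  measurable_fun setT (fun w => phi (y (Sum s w))).
Proof.
exact: (measurable_fun_countable (fun a => phi (y a)) (@random_element_sum s)).
Qed.

Let mW l (phi : R -> \bar R) : measurable_fun setT (fun w => phi (y (W l w))).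
Proof. exact: (measurable_fun_countable (fun a => phi (y a)) (@rW l)). Qed.

Lemma sum_mean (s : seq K) : uniq s ->
  (\int[P]_w (y (Sum s w))%:E)%E = (\sum_(k <- s) mu k)%:E.
Proof.
elim: s => [_|l s IH /[dup] ls /=/andP[_ us]].
  under eq_integral do rewrite big_nil y0.
  by rewrite integral_probability_cst big_nil.
under eq_integral do rewrite big_cons yD EFinD.
rewrite ge0_integralD//; try by [move=> w _; rewrite lee_fin
  |exact: (mW l EFin)|exact: (msum s EFin)].
by rewrite W_mean IH// big_cons EFinD.
Qed.

Lemma tau_ge0 l : 0 <= tau l.
Proof.
have := W_var l (mu l); rewrite subrr expr0n addr0 => h.
rewrite -lee_fin -h.
by apply: integral_ge0 => w' _; rewrite lee_fin sqr_ge0.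
Qed.

(** The centre c is arbitrary because it moves along the induction: integrating out [W l] with the
    other summands frozen uses the centre c minus their sum, and the induction hypothesis is then
    used at [c - mu l]. *)
Lemma sum_var (s : seq K) c : uniq s ->
  (\int[P]_w ((y (Sum s w) - c) ^+ 2)%:E)%E =
  (\sum_(k <- s) tau k + (\sum_(k <- s) mu k - c) ^+ 2)%:E.
Proof.
elim: s c => [c _|l s IH c /[dup] ls /=/andP[_ us]].
  under eq_integral do rewrite big_nil y0.
  by rewrite integral_probability_cst !big_nil !add0r.
rewrite (@integral_sum_cons (fun r => ((r - c) ^+ 2)%:E))//; last first.
  by move=> r; rewrite lee_fin sqr_ge0.
have e1 a b : a + b - c = b - (c - a) by ring.
have e2 a b : a - (c - b) = b - (c - a) by ring.
under eq_integral => w _.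
  under eq_integral => w' _ do rewrite e1.
  rewrite W_var e2 EFinD.
  over.
rewrite ge0_integralD//; first last.
- exact: (msum s (fun r => ((r - (c - mu l)) ^+ 2)%:E)).
- by move=> w _; rewrite lee_fin sqr_ge0.
- by move=> w _; rewrite lee_fin tau_ge0.
rewrite integral_probability_cst IH// -EFinD !big_cons.
by congr _%:E; ring.
Qed.

(** [expR a >= (1 + a / 2) ^+ 2], and the product of this square with the right-hand side is 1 plus
    nonnegative terms. A quadratic majorant on all of the half-line a >= 0 is what lets second
    moments alone yield an exponential lower tail. *)
Lemma expRN_le (a : R) : 0 <= a -> expR (- a) <= 1 - a + a ^+ 2.
Proof.
move=> a0; rewrite expRN -[leLHS]mul1r ler_pdivrMr ?expR_gt0//.
have e : (1 + a / 2) ^+ 2 <= expR a.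
  have -> : expR a = expR (a / 2) ^+ 2 by rewrite expr2 -expRD -splitr.
  have a2 : 0 <= a / 2 by rewrite divr_ge0.
  by rewrite lerXn2r ?nnegrE ?expR_ge0 ?expR_ge1Dx// addr_ge0.
have q : 0 <= 1 - a + a ^+ 2 by nra.
apply: le_trans (ler_wpM2l q e).
rewrite [leRHS](_ : _ = 1 + (a ^+ 2 + 3 * a ^+ 3 + a ^+ 4) / 4); last by field.
by rewrite lerDl divr_ge0// !addr_ge0 ?mulr_ge0 ?exprn_ge0.
Qed.

Lemma mgf1 l (t : R) : 0 <= t ->
  (\int[P]_w (expR (- (t * y (W l w))))%:E <=
  (expR (t ^+ 2 * (tau l + mu l ^+ 2) - t * mu l))%:E)%E.
Proof.
move=> t0.
have q : (\int[P]_w ((y (W l w)) ^+ 2)%:E = (tau l + mu l ^+ 2)%:E)%E.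
  have := W_var l 0; rewrite subr0 => <-.
  by apply: eq_integral => w _; rewrite subr0.
have E0 w : (0 <= (expR (- (t * y (W l w))))%:E)%E by rewrite lee_fin expR_ge0.
have mE := mW l (fun r => (expR (- (t * r)))%:E).
(* The linear term goes to the left so that both integrands are nonnegative, as [ge0_integralD]
   requires. *)
have : (\int[P]_w ((expR (- (t * y (W l w))))%:E + t%:E * (y (W l w))%:E)
   <= \int[P]_w (1 + (t ^+ 2)%:E * ((y (W l w)) ^+ 2)%:E))%E.
  apply: ge0_le_integral => //.
  - by move=> w _; rewrite adde_ge0// mule_ge0// lee_fin.
  - apply: emeasurable_funD => //.
    exact: (mW l (fun r => t%:E * r%:E)%E).
  - apply: emeasurable_funD => //.
    exact: (mW l (fun r => (t ^+ 2)%:E * (r ^+ 2)%:E)%E).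
  - move=> w _; rewrite -!EFinM -!EFinD lee_fin.
    have := @expRN_le (t * y (W l w)); rewrite mulr_ge0// => /(_ isT).
    by rewrite exprMn; lra.
rewrite ge0_integralD//; last 2 first.
- by move=> w _; rewrite mule_ge0// lee_fin.
- exact: (mW l (fun r => t%:E * r%:E)%E).
rewrite ge0_integralD//; last 2 first.
- by move=> w _; rewrite mule_ge0// lee_fin ?sqr_ge0.
- exact: (mW l (fun r => (t ^+ 2)%:E * (r ^+ 2)%:E)%E).
rewrite !ge0_integralZl//; try by [move=> w _; rewrite lee_fin ?sqr_ge0
  |rewrite lee_fin ?sqr_ge0|exact: (mW l EFin)
  |exact: (mW l (fun r => (r ^+ 2)%:E)%E)].
rewrite integral_probability_cst W_mean q -!EFinM -EFinD.
rewrite -leeBrDr// -EFinB => /le_trans; apply; rewrite lee_fin.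
set b := t ^+ 2 * _; rewrite -addrA; exact: expR_ge1Dx.
Qed.

Lemma mgf (s : seq K) (t : R) : 0 <= t -> uniq s ->
  (\int[P]_w (expR (- (t * y (Sum s w))))%:E <=
  (expR (t ^+ 2 * (\sum_(k <- s) (tau k + mu k ^+ 2))
         - t * \sum_(k <- s) mu k))%:E)%E.
Proof.
move=> t0; elim: s => [_|l s IH /[dup] ls /=/andP[_ us]].
  under eq_integral do rewrite big_nil y0.
  by rewrite integral_probability_cst !big_nil !mulr0 subrr oppr0.
rewrite (@integral_sum_cons (fun r => (expR (- (t * r)))%:E))//.
under eq_integral => w _.
  under eq_integral => w' _ do rewrite mulrDr opprD expRD EFinM.
  rewrite ge0_integralZl//; try exact: (mW l (fun r => (expR (- (t * r)))%:E)).
  over.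
rewrite ge0_integralZr//; try exact: (msum s (fun r => (expR (- (t * r)))%:E));
  last by apply: integral_ge0.
apply: (le_trans (lee_pmul _ _ (IH us) (mgf1 l t0))); try exact: integral_ge0.
by rewrite -EFinM -expRD !big_cons lee_fin ler_expR; lra.
Qed.

(** Chernoff's bound; t stays free and is optimised in [popsum_tail]. *)
Lemma sum_lower_tail (s : seq K) (a t : R) : 0 <= t -> uniq s ->
  (P [set w | (y (Sum s w) <= a)%R] <=
  (expR (t * a + (t ^+ 2 * (\sum_(k <- s) (tau k + mu k ^+ 2))
         - t * \sum_(k <- s) mu k)))%:E)%E.
Proof.
move=> t0 us; set A := [set w | _].
have mA : measurable A.
  exact: (random_element_preimage [set b | y b <= a] (@random_element_sum s)).
rewrite expRD EFinM -(setIT A) -integral_indic//.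
apply: (@le_trans _ _ (\int[P]_w ((expR (t * a))%:E *
   (expR (- (t * y (Sum s w))))%:E))%E).
  apply: ge0_le_integral => //.
  - apply/measurable_EFinP; exact: measurable_indic.
  - exact: (msum s (fun r => (expR (t * a))%:E * (expR (- (t * r)))%:E)%E).
  - move=> w _; rewrite -EFinM lee_fin -expRD indicE.
    case: (boolP (w \in A)) => wA /=; last by rewrite expR_ge0.
    rewrite -(expR0 R) ler_expR subr_ge0 ler_wpM2l//.
    by move: wA; rewrite inE.
rewrite ge0_integralZl//; try exact: (msum s (fun r => (expR (- (t * r)))%:E)).
by rewrite lee_pmul2l// ?lte_fin ?expR_gt0// mgf.
Qed.

(** Without variance the sum is almost surely its mean. This case is kept apart because the tail
    bound of [popsum_tail] has to vanish with the variance. *)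
Lemma sum_degenerate (s : seq K) (a : R) : uniq s ->
  \sum_(k <- s) tau k = 0 -> a < \sum_(k <- s) mu k ->
  P [set w | (y (Sum s w) <= a)%R] = 0%E.
Proof.
move=> us tau0 amu; set A := [set w | _].
have mA : measurable A.
  exact: (random_element_preimage [set b | y b <= a] (@random_element_sum s)).
have mI : measurable_fun setT (fun w => (\1_A w : R)%:E).
  by apply/measurable_EFinP; exact: measurable_indic.
set c := \sum_(k <- s) mu k in amu *.
have c0 : 0 < (c - a) ^+ 2 by rewrite exprn_gt0// subr_gt0.
apply/eqP; rewrite eq_le measure_ge0 andbT.
rewrite -(@lee_pmul2l _ ((c - a) ^+ 2)%:E)// mule0.
rewrite -(setIT A) -integral_indic// -ge0_integralZl//; try by [rewrite lee_fin ltW|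
  apply/measurable_EFinP; exact: measurable_indic].
apply: (@le_trans _ _ (\int[P]_w ((y (Sum s w) - c) ^+ 2)%:E)%E).
  apply: ge0_le_integral => //.
  - by move=> w _; rewrite mule_ge0// lee_fin ltW.
  - exact: (emeasurable_funM (measurable_cst _) mI).
  - exact: (msum s (fun r => ((r - c) ^+ 2)%:E)).
  - move=> w _; rewrite -EFinM lee_fin indicE.
    case: (boolP (w \in A)) => wA /=; last by rewrite mulr0 sqr_ge0.
    move: wA; rewrite inE mulr1 /A /= => wA.
    rewrite -subr_ge0; set b := y _ in wA *.
    rewrite (_ : _ - _ = (a - b) * ((c - a) + (c - b))); last by ring.
    have ac := ltW amu; have bc := le_trans wA ac.
    apply: mulr_ge0; first by rewrite subr_ge0.
    by apply: addr_ge0; rewrite subr_ge0.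
by rewrite sum_var// tau0 /c subrr expr0n addr0.
Qed.

End independent_sums.

(** * The Lyapunov function *)

Section real_functions.
Context {R : realType}.
Implicit Types (x y a b c : R).

Lemma derivable_segment_continuous (f df : R -> R) a b :
  (forall x, a <= x <= b -> is_derive x 1 f (df x)) ->
  {within `[a, b], continuous f}.
Proof.
move=> fd; apply: derivable_within_continuous => x; rewrite in_itv /= => xab.
by have [] := fd _ xab.
Qed.

Lemma mean_value (f df : R -> R) a b : a <= b ->
  (forall x, a <= x <= b -> is_derive x 1 f (df x)) ->
  exists2 c, a <= c <= b & f b - f a = df c * (b - a).
Proof.
move=> ab fd.
have fo x : x \in `]a, b[ -> is_derive x 1 f (df x).
  by rewrite in_itv /= => /andP[ax xb]; apply: fd; rewrite !ltW.
have [c cab e] := MVT_segment ab fo (derivable_segment_continuous fd).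
by exists c => //; move: cab; rewrite in_itv.
Qed.

(** The quadratic majorant minus f, called [G], has a derivative with the sign of [t - x], hence its
    minimum at x. The mean value theorem suffices, on either side of x, and f'' need not be
    continuous. *)
Lemma taylor2_le (f f' f'' : R -> R) a K :
  (forall x, a <= x -> is_derive x 1 f (f' x)) ->
  (forall x, a <= x -> is_derive x 1 f' (f'' x)) ->
  (forall x, a <= x -> f'' x <= K) ->
  forall x y, a <= x -> a <= y ->
    f y <= f x + f' x * (y - x) + K / 2 * (y - x) ^+ 2.
Proof.
move=> df df' f''K x y ax ay.
have h b c : a <= b -> b <= c -> f' c - f' b <= K * (c - b).
  move=> ab bc; have [|t /andP[bt tc] ->] := @mean_value f' f'' b c bc.
    by move=> t /andP[bt _]; apply: df'; exact: le_trans bt.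
  by apply: ler_wpM2r; rewrite ?subr_ge0// f''K// (le_trans ab).
pose G t := (K / 2) * (t - x) ^+ 2 + f' x * (t - x) - f t.
pose G' t := K * (t - x) + f' x - f' t.
have dG t : a <= t -> is_derive t 1 G (G' t).
  move=> /df fd; apply: is_derive_eq; rewrite /G' /GRing.scale /=.
  by field.
have [xy|/ltW yx] := leP x y.
  have [|t /andP[xt ty]] := @mean_value G G' x y xy.
    by move=> t /andP[xt _]; apply: dG; exact: le_trans xt.
  have : 0 <= G' t * (y - x).
    by rewrite mulr_ge0 ?subr_ge0// /G'; have := h _ _ ax xt; lra.
  by rewrite /G subrr expr0n /= mulr0; lra.
have [|t /andP[xt ty]] := @mean_value G G' y x yx.
  by move=> t /andP[xt _]; apply: dG; exact: le_trans xt.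
have : G' t * (x - y) <= 0.
  by rewrite mulr_le0_ge0 ?subr_ge0// /G'; have := h _ _ (le_trans ay xt) ty; lra.
by rewrite /G subrr expr0n /= mulr0; lra.
Qed.

Lemma ler_powRN r a b : 0 <= r -> 0 < a -> a <= b -> b `^ (- r) <= a `^ (- r).
Proof.
move=> r0 a0 ab; rewrite !powRN lef_pV2 ?posrE ?powR_gt0//.
  by apply: ge0_ler_powR => //; rewrite nnegrE ltW// (lt_le_trans a0).
exact: lt_le_trans ab.
Qed.

Variables (alpha : R) (alpha0 : 0 < alpha).

(** The two shifts by 1 keep [1 + y] and [ell y] at least 1 from 0 on, so [lyap] is smooth and at
    most 1 on the whole range of heights. *)
Definition ell y : R := 1 + ln (1 + y).
Definition lyap y : R := ell y `^ (- alpha).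
(** The derivative of [lyap] is [- alpha * slope] and that of [slope] is [- curv], so [alpha * curv]
    is the second derivative of [lyap]. *)
Definition slope y : R := (1 + y)^-1 * ell y `^ (- alpha - 1).
Definition curv y : R := (1 + y)^-1 * slope y * (1 + (1 + alpha) / ell y).

Lemma ell_ge1 y : 0 <= y -> 1 <= ell y.
Proof. by move=> y0; rewrite lerDl ln_ge0// lerDl. Qed.

Lemma ell_gt0 y : 0 <= y -> 0 < ell y.
Proof. by move=> /ell_ge1; exact: lt_le_trans. Qed.

Lemma ler_ell x y : 0 <= x -> x <= y -> ell x <= ell y.
Proof.
move=> x0 xy; rewrite lerD2l ler_ln ?posrE ?lerD2l//; last first.
  by rewrite ltr_pwDl// (le_trans x0).
by rewrite ltr_pwDl.
Qed.

Lemma ltr_ell x y : 0 <= x -> x < y -> ell x < ell y.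
Proof.
move=> x0 xy; rewrite ltrD2l ltr_ln ?posrE ?ltrD2l//; last first.
  by rewrite ltr_pwDl// (le_trans x0)// ltW.
by rewrite ltr_pwDl.
Qed.

Lemma lyap_gt0 y : 0 <= y -> 0 < lyap y.
Proof. by move=> y0; rewrite powR_gt0 ?ell_gt0. Qed.

Lemma lyap_le1 y : 0 <= y -> lyap y <= 1.
Proof.
move=> y0; have e : 1 `^ (- alpha) = 1 :> R by rewrite powR1.
by rewrite -[leRHS]e ler_powRN ?ell_ge1// ltW.
Qed.

Lemma ler_lyap x y : 0 <= x -> x <= y -> lyap y <= lyap x.
Proof.
by move=> x0 xy; rewrite ler_powRN ?ell_gt0 ?ler_ell// ltW.
Qed.

Lemma ltr_lyap x y : 0 <= x -> x < y -> lyap y < lyap x.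
Proof.
move=> x0 xy; rewrite /lyap !powRN ltf_pV2 ?posrE ?powR_gt0 ?ell_gt0//; last first.
  by rewrite (le_trans x0)// ltW.
have xE := ell_gt0 x0; apply: gt0_ltr_powR => //; rewrite ?nnegrE ?ltr_ell// ltW//.
exact: lt_trans (ltr_ell x0 xy).
Qed.

Lemma slope_gt0 y : 0 <= y -> 0 < slope y.
Proof.
by move=> y0; rewrite mulr_gt0 ?invr_gt0 ?powR_gt0 ?ell_gt0// ltr_pwDl.
Qed.

Lemma is_derive_ell y : 0 <= y -> is_derive y 1 ell (1 + y)^-1.
Proof.
move=> y0.
have y1 : 0 < 1 + y by rewrite ltr_pwDl.
have e : is_derive y 1 (fun t : R => 1 + t) 1.
  by apply: is_derive_eq; rewrite add0r mulr1.
have := @is_derive1_comp R (@ln R) (fun t => 1 + t) y _ _ (is_derive1_ln y1) e.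
rewrite mulr1 => e2.
by have := is_deriveD (is_derive_cst (1 : R) y 1) e2; rewrite add0r.
Qed.

Lemma is_derive_lyap y : 0 <= y -> is_derive y 1 lyap (- alpha * slope y).
Proof.
move=> y0; have := @is_derive1_comp R (@powR R ^~ (- alpha)) ell y _ _
  (is_derive1_powR _ (ell_gt0 y0)) (is_derive_ell y0).
by rewrite /slope -mulrA [_ `^ _ * _]mulrC.
Qed.

Lemma is_derive_slope y : 0 <= y -> is_derive y 1 slope (- curv y).
Proof.
move=> y0.
have y1 : 0 < 1 + y by rewrite ltr_pwDl.
have d1 := @is_derive1_comp R (@powR R ^~ (- alpha - 1)) ell y _ _
  (is_derive1_powR _ (ell_gt0 y0)) (is_derive_ell y0).
have d2 : is_derive y 1 (fun t : R => (1 + t)^-1) (- (1 + y) ^- 2).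
  have e1 : is_derive y 1 (fun t : R => 1 + t) 1.
    by apply: is_derive_eq; rewrite add0r mulr1.
  have := is_deriveV (lt0r_neq0 y1) e1; by rewrite /GRing.scale /= mulr1.
have := is_deriveM d2 d1.
have l0 := lt0r_neq0 (ell_gt0 y0); have y10 := lt0r_neq0 y1.
have -> : ell y `^ (- alpha - 1 - 1) = ell y `^ (- alpha - 1) / ell y.
  rewrite powRD ?l0 ?implybT//; congr (_ * _).
  by rewrite powR_inv1 ?ltW ?ell_gt0.
rewrite /GRing.scale /=; set A := ell y `^ _.
have -> // : (1 + y)^-1 * ((- alpha - 1) * (A / ell y) / (1 + y)) +
  A * - (1 + y) ^- 2 = - curv y.
by rewrite /curv /slope -/A; field; rewrite l0 y10.
Qed.

Lemma curv_gt0 y : 0 <= y -> 0 < curv y.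
Proof.
move=> y0; have a1 : 0 < 1 + alpha by rewrite addr_gt0.
have y1 : 0 < 1 + y by rewrite ltr_pwDl.
by rewrite /curv pmulr_rgt0 ?addr_gt0 ?divr_gt0 ?ell_gt0// mulr_gt0 ?slope_gt0 ?invr_gt0.
Qed.

Lemma ler_slope x y : 0 <= x -> x <= y -> slope y <= slope x.
Proof.
move=> x0 xy; have y0 := le_trans x0 xy; rewrite ler_pM ?powR_ge0//.
- by rewrite invr_ge0 addr_ge0.
- by rewrite lef_pV2 ?posrE ?ltr_pwDl// lerD2l.
rewrite -opprD ler_powRN ?ell_gt0 ?ler_ell//.
by rewrite ltW// addr_gt0.
Qed.

Lemma ler_curv x y : 0 <= x -> x <= y -> curv y <= curv x.
Proof.
move=> x0 xy; have y0 := le_trans x0 xy.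
have a1 : 0 < 1 + alpha by rewrite addr_gt0.
rewrite ler_pM//.
- by rewrite mulr_ge0 ?(ltW (slope_gt0 _))// invr_ge0 addr_ge0.
- by rewrite addr_ge0// divr_ge0 ?ltW ?ell_gt0.
- rewrite ler_pM ?ler_slope ?(ltW (slope_gt0 _))//.
  + by rewrite invr_ge0 addr_ge0.
  + by rewrite lef_pV2 ?posrE ?ltr_pwDl// lerD2l.
rewrite lerD2l ler_pM2l// lef_pV2 ?posrE ?ell_gt0//.
exact: ler_ell.
Qed.

Lemma lyap_taylor a x y : 0 <= a -> a <= x -> a <= y ->
  lyap y <= lyap x - alpha * slope x * (y - x)
    + alpha * curv a / 2 * (y - x) ^+ 2.
Proof.
move=> a0 ax ay; rewrite -mulNr -mulNr.
apply: (@taylor2_le lyap (fun t => - alpha * slope t)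
  (fun t => alpha * curv t) a) => //.
- by move=> t at0; apply: is_derive_lyap; exact: le_trans at0.
- move=> t at0.
  have := is_deriveZ (- alpha) (is_derive_slope (le_trans a0 at0)).
  by rewrite /GRing.scale /= mulrNN.
- by move=> t at0; rewrite ler_pM2l// ler_curv.
Qed.

(* With q = 1 - e, each of the 4 + alpha factors q ^-1 pays for one comparison
   between the values at [q x] and at [x]. *)
Lemma curv_le_slope (eta : R) : 0 < eta -> exists2 q, 0 < q < 1 &
  exists x0, forall x, 0 <= x -> x0 <= x ->
    curv (q * x) <= (1 + eta) * (slope x / (1 + x)).
Proof.
move=> eta0; pose r : R := 4 + alpha.
have r0 : 0 < r by rewrite addr_gt0.
pose q : R := (1 + eta) `^ (- r^-1).
have e1 : 1 < 1 + eta by rewrite ltrDl.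
have q0 : 0 < q by rewrite powR_gt0// (lt_trans ltr01).
have q1 : q < 1.
  rewrite /q powRN invf_lt1 ?powR_gt0 ?(lt_trans ltr01)//.
  have := @gt0_ltr_powR R r^-1; rewrite invr_gt0 => /(_ r0 1 (1 + eta)).
  by rewrite powR1 !nnegrE; apply => //; rewrite ltW// (lt_trans ltr01).
exists q; first by rewrite q0.
have qr : q `^ (- r) = 1 + eta.
  rewrite /q -powRrM mulrNN mulVf ?lt0r_neq0// powRr1// ltW//.
  exact: lt_trans e1.
(* The first bound gives [- ln q <= (1 - q) * ell x], hence [q * ell x <= ell (q * x)]; with the
   second, the last factor of [curv] at [q * x] is at most [q^-1]. *)
pose L := Num.max (- ln q / (1 - q)) ((1 + alpha) / (1 - q)).
exists (expR L) => x x0 Lx.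
have qx0 : 0 <= q * x by rewrite mulr_ge0// ltW.
have qx : q * x <= x by rewrite ler_piMl// ltW.
have qb : 0 < 1 - q by rewrite subr_gt0.
have x1 : 0 < 1 + x by rewrite ltr_pwDl.
have qx1 : 0 < 1 + q * x by rewrite ltr_pwDl.
have lL : L <= ell x.
  rewrite /ell -[L]expRK (le_trans _ (_ : ln (1 + x) <= _)) ?lerDr//.
  by rewrite ler_ln ?posrE ?expR_gt0// (le_trans Lx)// lerDr.
have := lL; rewrite ge_max !ler_pdivrMr// => /andP[L1 L2].
have f1 : q * (1 + x) <= 1 + q * x by rewrite mulrDr mulr1 lerD2r ltW.
have f2 : q * ell x <= ell (q * x).
  have : ln (q * (1 + x)) <= ln (1 + q * x).
    by rewrite ler_ln ?posrE ?mulr_gt0.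
  by rewrite lnM ?posrE// /ell in L1 *; lra.
have lx := ell_gt0 x0; have lqx := ell_gt0 qx0.
have f3 : 1 + (1 + alpha) / ell (q * x) <= q^-1.
  rewrite -lerBrDl ler_pdivrMr// (le_trans L2)//.
  rewrite (_ : q^-1 - 1 = (1 - q) * q^-1); last by field; rewrite lt0r_neq0.
  rewrite [ell x * _]mulrC -mulrA ler_pM2l// ler_pdivlMl//.
have f4 : ell (q * x) `^ (- alpha - 1) <= q `^ (- alpha - 1) * ell x `^ (- alpha - 1).
  rewrite -powRM ?(ltW q0) ?(ltW lx)// -opprD ler_powRN ?mulr_gt0//.
  by rewrite addr_ge0// ltW.
have f5 : (1 + q * x)^-1 <= q^-1 * (1 + x)^-1.
  by rewrite -invfM lef_pV2 ?posrE ?mulr_gt0.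
apply: (@le_trans _ _ ((q^-1 * (1 + x)^-1) * ((q^-1 * (1 + x)^-1) *
   (q `^ (- alpha - 1) * ell x `^ (- alpha - 1))) * q^-1)).
  have i0 : 0 <= (1 + q * x)^-1 by rewrite invr_ge0 ltW.
  rewrite /curv /slope !ler_pM// ?mulr_ge0 ?powR_ge0//.
  by rewrite addr_ge0// divr_ge0 ?ltW// addr_gt0.
rewrite le_eqVlt; apply/orP; left; apply/eqP.
have -> : 1 + eta = q^-1 * q^-1 * q^-1 * q `^ (- alpha - 1).
  rewrite -qr /r (_ : - (4 + alpha) = - 3%:R + (- alpha - 1)); last by ring.
  rewrite powRD ?lt0r_neq0 ?implybT// powR_invn ?(ltW q0)//.
  by congr (_ * _); rewrite -exprVn !exprS expr0 mulr1 mulrA.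
by rewrite /slope; ring.
Qed.

Lemma ln_le_linear c : 0 < c -> exists C : R, forall x, 0 <= x ->
  ln (1 + x) <= c * x + C.
Proof.
move=> c0; exists (c - ln c) => x x0.
have x1 : 0 < 1 + x by rewrite ltr_pwDl.
have := @ln_sublinear R (c * (1 + x)); rewrite mulr_gt0// => /(_ isT).
by rewrite lnM ?posrE//; lra.
Qed.

(** The factor x is there because the exponential tail comes multiplied by [sigma2], which is at
    most [2 * x * h]. *)
Lemma exp_negligible_slope c kappa : 0 < c -> 0 < kappa ->
  exists x0, forall x, 0 <= x -> x0 <= x -> x * expR (- (c * x)) <= kappa * slope x.
Proof.
move=> c0 k0.
have r0 : 0 < 3 + alpha by rewrite addr_gt0.
have ltr02 : 0 < 2 :> R by [].
(* With this coefficient the power [3 + alpha] of [1 + x] uses up half of the exponent [c * x]; the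
   other half absorbs the constants once x is large. *)
have [C CH] := ln_le_linear (divr_gt0 (divr_gt0 c0 ltr02) r0).
pose C' := (3 + alpha) * C.
exists ((C' - ln kappa) * (2 / c)) => x x0 xL.
have x1 : 0 < 1 + x by rewrite ltr_pwDl.
have l0 := ell_gt0 x0.
have lx : ell x <= 1 + x by rewrite lerD2l le_ln1Dx// (lt_le_trans _ x0).
have s1 : (1 + x) `^ (- alpha - 2) <= slope x.
  have -> : (1 + x) `^ (- alpha - 2) = (1 + x)^-1 * (1 + x) `^ (- alpha - 1).
    rewrite (_ : - alpha - 2 = -1 + (- alpha - 1)); last by ring.
    by rewrite powRD ?lt0r_neq0 ?implybT// powR_inv1// ltW.
  rewrite ler_pM2l ?invr_gt0// -opprD ler_powRN//.
  by rewrite ltW// addr_gt0.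
apply: (le_trans _ (ler_wpM2l (ltW k0) s1)).
rewrite (_ : - alpha - 2 = 1 - (3 + alpha)); last by ring.
rewrite powRD ?lt0r_neq0 ?implybT// powRr1 ?(ltW x1)// powRN [leRHS]mulrCA.
apply: ler_pM; rewrite ?expR_ge0 ?lerDr//.
rewrite ler_pdivlMr ?powR_gt0// /powR gt_eqF// -expRD.
rewrite -[kappa]lnK ?posrE// ler_expR.
have := CH x x0; rewrite -(ler_pM2l r0) => h.
have := xL; rewrite mulrA ler_pdivrMr// => h2.
apply: le_trans (_ : - (c * x) + (c / 2 * x + C') <= _).
  rewrite lerD2l (le_trans h)// mulrDr mulrA [_ * (_ / _)]mulrC divfK ?lt0r_neq0//.
by lra.
Qed.

(** Converts the rate of the moment condition into a multiple of [slope]. From x = e on,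
    [1 + x <= 2 * x], and [1 + x <= x * x] gives [ell x <= 1 + 2 * ln x <= 3 * ln x]: hence the 2
    and the 3. *)
Lemma lnV_le_slope : exists2 C, 0 < C & exists x0, forall x, 0 <= x -> x0 <= x ->
  0 < ln x /\ x^-1 / ln x `^ (1 + alpha) <= C * slope x.
Proof.
have a1 : 0 < 1 + alpha by rewrite addr_gt0.
exists (2 * 3 `^ (1 + alpha)); first by rewrite mulr_gt0// powR_gt0.
exists (expR 1) => x _ ex.
have x2 : 2 <= x by apply: le_trans ex; rewrite (le_trans _ (expR_ge1Dx _)).
have x0 : 0 < x by apply: lt_le_trans x2.
have lnx : 1 <= ln x by rewrite -[1]expRK ler_ln ?posrE ?expR_gt0.
have lnx0 : 0 < ln x by apply: lt_le_trans lnx.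
split=> //; have l0 := ell_gt0 (ltW x0).
have h1 : ell x <= 3 * ln x.
  have : ln (1 + x) <= ln (x * x).
    by rewrite ler_ln ?posrE ?mulr_gt0 ?addr_gt0//; nra.
  by rewrite lnM ?posrE// /ell; lra.
rewrite /slope -opprD [alpha + 1]addrC powRN.
set A := ln x `^ _; set B := ell x `^ _; set T3 := 3 `^ _.
have A0 : 0 < A by rewrite powR_gt0.
have B0 : 0 < B by rewrite powR_gt0.
have BA : B <= T3 * A.
  rewrite /T3 /A -powRM// ?(ltW lnx0)//; apply: ge0_ler_powR => //.
  - exact: ltW.
  - by rewrite nnegrE ltW.
  - by rewrite nnegrE mulr_ge0// ltW.
rewrite -!invfM ler_pdivlMr ?mulr_gt0 ?addr_gt0// ler_pdivrMl ?mulr_gt0//.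
rewrite (_ : x * A * _ = (2 * x) * (T3 * A)); last by ring.
by apply: ler_pM => //; [rewrite addr_ge0// ltW|exact: ltW|lra].
Qed.

End real_functions.

(** * Quadratic moments *)

Section moments.
Context {d : measure_display} {T : measurableType d} {R : realType}.
Variable P : probability T R.

(** Integrability travels with the value, so that linearity applies to signed functions without side
    conditions. *)
Definition has_mean (f : T -> R) (e : R) :=
  f \in Lfun P 1 /\ (\int[P]_w (f w)%:E)%E = e%:E.

Lemma has_mean_cst c : has_mean (fun=> c) c.
Proof.
by split; [exact: Lfun_cst|rewrite integral_probability_cst].
Qed.

Lemma has_meanD f g a b : has_mean f a -> has_mean g b ->
  has_mean (fun w => f w + g w) (a + b).
Proof.
move=> [fL fa] [gL gb]; split; first exact: rpredD.
have := expectationD fL gL; rewrite unlock fa gb => h.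
by rewrite EFinD -h.
Qed.

Lemma has_meanZ k f a : has_mean f a -> has_mean (fun w => k * f w) (k * a).
Proof.
move=> [fL fa].
have -> : (fun w => k * f w) = k \o* f by apply/funext => w /=; rewrite mulrC.
split; first exact: Lfun_scale.
by have := expectationZl k fL; rewrite unlock fa EFinM.
Qed.

Lemma has_mean_sum (I : Type) (r : seq I) (f : I -> T -> R) (a : I -> R) :
  (forall i, has_mean (f i) (a i)) ->
  has_mean (fun w => \sum_(i <- r) f i w) (\sum_(i <- r) a i).
Proof.
move=> fa; elim: r => [|i r IH].
  rewrite big_nil (_ : (fun _ => _) = fun=> 0); first exact: has_mean_cst.
  by apply/funext => w; rewrite big_nil.
rewrite big_cons (_ : (fun _ => _) = fun w => f i w + \sum_(j <- r) f j w).
  exact: has_meanD.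
by apply/funext => w; rewrite big_cons.
Qed.

Lemma has_mean_indic (A : set T) : measurable A -> has_mean \1_A (fine (P A)).
Proof.
move=> mA; have e : (\int[P]_w (\1_A w)%:E = P A)%E.
  by rewrite integral_indic// setIT.
split; last by rewrite e fineK// fin_num_measure.
apply/Lfun1_integrable; apply: integrable_indic => //.
Qed.

Lemma has_mean_ext f g a b : has_mean f a -> f =1 g -> a = b -> has_mean g b.
Proof. by move=> fa /funext <- <-. Qed.

Variables (p : nat) (u : 'cV[R]_p).

Lemma dotE (x : 'cV[R]_p) : dot u x = \sum_l u l 0 * x l 0.
Proof. by rewrite /dot mxE; apply: eq_bigr => l _; rewrite mxE. Qed.

Variables (Y : T -> 'cV[R]_p) (YL2 : square_integrable P Y).

Let YL1 l : (fun w => Y w l 0) \in Lfun P 1.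
Proof. by apply: Lfun_subset12 (YL2 l); rewrite fin_num_measure. Qed.

Lemma has_mean_coord l : has_mean (fun w => Y w l 0) (mean_vec P Y l 0).
Proof.
split; first exact: YL1.
by rewrite mxE fineK ?expectation_fin_num// unlock.
Qed.

Lemma has_mean_coord2 l l' : has_mean (fun w => Y w l 0 * Y w l' 0)
  (cov_mx P Y l l' + mean_vec P Y l 0 * mean_vec P Y l' 0).
Proof.
have YY := Lfun2_mul_Lfun1 (YL2 l) (YL2 l'); split; first exact: YY.
rewrite mxE covarianceE//.
rewrite !mxE EFinD EFinM !fineK ?expectation_fin_num//.
  by rewrite subeK ?fin_numM ?expectation_fin_num// unlock.
by rewrite fin_numB fin_numM ?expectation_fin_num.
Qed.

Lemma has_mean_dot : has_mean (fun w => dot u (Y w)) (dot u (mean_vec P Y)).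
Proof.
apply: has_mean_ext (has_mean_sum (index_enum _) (fun l =>
  has_meanZ (u l 0) (has_mean_coord l))) _ _ => [w|]; by rewrite dotE.
Qed.

Lemma has_mean_dot2 : has_mean (fun w => dot u (Y w) ^+ 2)
  (dot u (cov_mx P Y *m u) + dot u (mean_vec P Y) ^+ 2).
Proof.
apply: has_mean_ext (has_mean_sum (index_enum _) (fun l =>
  has_mean_sum (index_enum _) (fun l' =>
   has_meanZ (u l 0 * u l' 0) (has_mean_coord2 l l')))) _ _ => [w|].
  rewrite dotE expr2 mulr_suml; apply: eq_bigr => l _.
  by rewrite mulr_sumr; apply: eq_bigr => l' _; ring.
transitivity (\sum_l (u l 0 * (cov_mx P Y *m u) l 0 +
    u l 0 * mean_vec P Y l 0 * dot u (mean_vec P Y))).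
  apply: eq_bigr => l _.
  transitivity (\sum_l' (u l 0 * (cov_mx P Y l l' * u l' 0) +
    u l 0 * mean_vec P Y l 0 * (u l' 0 * mean_vec P Y l' 0))).
    by apply: eq_bigr => l' _ /=; ring.
  by rewrite big_split /= -!mulr_sumr -dotE [(_ *m _) _ _]mxE.
by rewrite big_split /= -mulr_suml -!dotE expr2.
Qed.

Lemma has_mean_dot_dev c : has_mean (fun w => (dot u (Y w) - c) ^+ 2)
  (dot u (cov_mx P Y *m u) + (dot u (mean_vec P Y) - c) ^+ 2).
Proof.
apply: has_mean_ext (has_meanD has_mean_dot2 (has_meanD
  (has_meanZ (- 2 * c) has_mean_dot) (has_mean_cst (c ^+ 2)))) _ _ => [w|];
by ring.
Qed.

End moments.

(** * One generation of the process *)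

Section one_step.
Context {d : measure_display} {T : measurableType d} {R : realType}.
Variables (P : probability T R) (p : nat).
Variables (Z0 : T -> 'cV[nat]_p) (X : nat -> nat -> 'I_p -> T -> 'cV[nat]_p)
  (Dm Im : nat -> 'cV[nat]_p -> T -> 'cV[nat]_p)
  (M : nat -> 'cV[nat]_p -> T -> 'cV[int]_p) (pz qz rz : 'cV[nat]_p -> 'I_p -> R).
Hypothesis model : is_mbpm P Z0 X Dm Im M pz qz rz.

Local Notation F := (mbpm_sigma Z0 X M).
Local Notation cyl := (cylinders (K := mbpm_label p) F).

Let FI l : setI_closed (F l).
Proof. by case: l => [[[]|[[k j] i]]|[k z]]; exact: sigma_ofI. Qed.

Let FT l : F l setT.
Proof. by case: l => [[[]|[[k j] i]]|[k z]]; exact: sigma_ofT. Qed.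

Let Fm l : F l `<=` measurable.
Proof.
case: l => [[[]|[[k j] i]]|[k z]]; first exact: mbpm_Z0_random model.
- exact: (mbpm_X_random model).
- exact: (mbpm_M_random model).
Qed.

Lemma disjoint_labels_independent (A B : set (mbpm_label p)) : A `&` B = set0 ->
  forall C D, <<s cyl A >> C -> <<s cyl B >> D ->
  P (C `&` D) = (P C * P D)%E.
Proof.
exact: (independent_labels (mbpm_independent model) FI FT Fm).
Qed.

Lemma label_sub (A : set (mbpm_label p)) l : A l -> F l `<=` <<s cyl A >>.
Proof.
move=> Al C FC; apply: sub_sigma_algebra; exact: cylinders1 Al _ FC.
Qed.

Lemma sigma_cyl (A : set (mbpm_label p)) : sigma_algebra setT <<s cyl A >>.
Proof. exact: smallest_sigma_algebra. Qed.

Definition popsum n (c : 'cV[nat]_p) (w : T) : 'cV[nat]_p :=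
  \sum_(i < p) \sum_(j < c i 0) X n j i w.

Definition reproducing (z : 'cV[nat]_p) (m : 'cV[int]_p) : 'cV[nat]_p :=
  \col_i `|((z i 0)%:Z + m i 0)%R|%N.

Definition step n (z : 'cV[nat]_p) (w : T) : 'cV[nat]_p :=
  popsum n (reproducing z (M n z w)) w.

Lemma mbpmS n w : mbpm Z0 X M n.+1 w = step n (mbpm Z0 X M n w) w.
Proof. by rewrite /= /step /popsum; apply: eq_bigr => i _; rewrite mxE. Qed.

(** A duplicate-free list turns the double sum over types and individuals into the single sums
    treated in [independent_sums]. *)
Definition individuals (c : 'cV[nat]_p) : seq (nat * 'I_p) :=
  [seq (j, i) | i <- enum 'I_p, j <- iota 0 (c i 0)].

Lemma individuals_uniq c : uniq (individuals c).
Proof.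
apply: allpairs_uniq_dep; first exact: enum_uniq.
- by move=> i _; exact: iota_uniq.
- by move=> [i j] [i' j'] _ _ /= [-> ->].
Qed.

Lemma sum_individuals (V : nmodType) c (f : nat -> 'I_p -> V) :
  \sum_(k <- individuals c) f k.1 k.2 = \sum_(i < p) \sum_(j < c i 0) f j i.
Proof.
rewrite /individuals big_allpairs_dep /= big_enum /=; apply: eq_bigr => i _.
have -> : iota 0 (c i 0) = index_iota 0 (c i 0) by rewrite /index_iota subn0.
by rewrite big_mkord.
Qed.

Lemma popsumE n c w : popsum n c w = \sum_(k <- individuals c) X n k.1 k.2 w.
Proof. by rewrite (sum_individuals c (fun j i => X n j i w)). Qed.

(** [past_labels] determine Z_n, and [step_labels] determine one generation from any frozen state;
    as the two sets are disjoint, the independence of the labels becomes the Markov property. *)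
Definition step_labels n : set (mbpm_label p) := fun l =>
  match l with inl (inl _) => False | inl (inr (k, _, _)) => k = n
  | inr (k, _) => k = n end.

Definition past_labels n : set (mbpm_label p) := fun l =>
  match l with inl (inl _) => True | inl (inr (k, _, _)) => (k < n)%N
  | inr (k, _) => (k < n)%N end.

Lemma offspring_sum_sigma n (s : seq (nat * 'I_p)) (A : set (mbpm_label p)) :
  (forall k, k \in s -> A (inl (inr (n, k.1, k.2)))) ->
  sigma_of (fun w => \sum_(k <- s) X n k.1 k.2 w) `<=` <<s cyl A >>.
Proof.
move=> sA; apply: (@sigma_of_sum _ _ _ (sigma_cyl A) (nat * 'I_p)%type
  p (fun k => X n k.1 k.2)) => -[j i] /sA.
exact: (@label_sub A (inl (inr (n, j, i)))).
Qed.

Lemma popsum_sigma n c : sigma_of (popsum n c) `<=` <<s cyl (step_labels n) >>.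
Proof.
rewrite (_ : popsum n c = fun w => \sum_(k <- individuals c) X n k.1 k.2 w); last first.
  by apply/funext => w; rewrite popsumE.
by apply: offspring_sum_sigma.
Qed.

Lemma step_sigma n z : sigma_of (step n z) `<=` <<s cyl (step_labels n) >>.
Proof.
apply: (@sigma_of_freeze _ _ _ (sigma_cyl _) 'cV[int]_p 'cV[nat]_p (M n z)
  (fun m => popsum n (reproducing z m))).
  exact: (@label_sub (step_labels n) (inr (n, z))).
by move=> m; exact: popsum_sigma.
Qed.

Lemma cyl_mono (A B : set (mbpm_label p)) : A `<=` B -> <<s cyl A >> `<=` <<s cyl B >>.
Proof.
move=> AB; apply: smallest_sub; first exact: sigma_cyl.
move=> C [s [E [us sA FE ->]]]; apply: sub_sigma_algebra.
by exists s, E; split => // l /sA /AB.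
Qed.

Lemma past_mono n m : (n <= m)%N -> past_labels n `<=` past_labels m.
Proof. by move=> nm [[[]|[[k j] i]]|[k z]] //= kn; exact: leq_trans nm. Qed.

Lemma mbpm_sigma_past n : sigma_of (mbpm Z0 X M n) `<=` <<s cyl (past_labels n) >>.
Proof.
elim: n => [|n IH].
  exact: (@label_sub (past_labels 0) (inl (inl tt))).
rewrite (_ : mbpm Z0 X M n.+1 = fun w => step n (mbpm Z0 X M n w) w); last first.
  by apply/funext => w; rewrite mbpmS.
apply: (sigma_of_freeze (sigma_cyl _)).
  by apply: (subset_trans IH); apply: cyl_mono; exact: past_mono.
move=> z; apply: (subset_trans (@step_sigma n z)); apply: cyl_mono.
by move=> [[[]|[[k j] i]]|[k z']] //= ->.
Qed.

Lemma past_step_disjoint n : past_labels n `&` step_labels n = set0.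
Proof.
rewrite -subset0 => -[[[]|[[k j] i]]|[k z]] [] //= /[swap] ->; by rewrite ltnn.
Qed.

Lemma past_measurable n : <<s cyl (past_labels n) >> `<=` measurable.
Proof.
apply: smallest_sub; first exact: sigma_algebra_measurable.
exact: cylinders_measurable.
Qed.

Lemma step_random n z : random_element (step n z).
Proof.
apply: (subset_trans (@step_sigma n z)); apply: smallest_sub.
  exact: sigma_algebra_measurable.
exact: cylinders_measurable.
Qed.

Lemma popsum_random n c : random_element (popsum n c).
Proof.
apply: (subset_trans (@popsum_sigma n c)); apply: smallest_sub.
  exact: sigma_algebra_measurable.
exact: cylinders_measurable.
Qed.

Lemma mbpm_random n : random_element (mbpm Z0 X M n).
Proof. exact: (subset_trans (@mbpm_sigma_past n) (@past_measurable n)). Qed.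

(** The Markov property for a frozen state z: it is applied to past events H inside Z_n = z, where
    [step n z] is the next state. *)
Lemma past_step_independent n z (H : set T) (B : set 'cV[nat]_p) :
  <<s cyl (past_labels n) >> H ->
  P (H `&` step n z @^-1` B) = (P H * P (step n z @^-1` B))%E.
Proof.
move=> sH; apply: (disjoint_labels_independent (past_step_disjoint n)) => //.
by move/sigma_ofP : (@step_sigma n z); exact.
Qed.

Lemma offspring_independent n (l : nat * 'I_p) s : uniq (l :: s) ->
  independent_elements P (fun w => \sum_(k <- s) X n k.1 k.2 w) (X n l.1 l.2).
Proof.
move=> /= /andP[ls _] A B.
pose LA : set (mbpm_label p) := fun m =>
  if m is inl (inr (k, j, i)) then k = n /\ (j, i) \in s else False.
pose LB : set (mbpm_label p) := [set inl (inr (n, l.1, l.2))].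
apply: (@disjoint_labels_independent LA LB).
- rewrite -subset0 => m []; rewrite /LB /= => /[swap] -> /= [_].
  by rewrite -surjective_pairing (negbTE ls).
- have /sigma_ofP : sigma_of (fun w => \sum_(k <- s) X n k.1 k.2 w) `<=`
      <<s cyl LA >>; last exact.
  by apply: offspring_sum_sigma => -[j i].
- exact: (@label_sub LB (inl (inr (n, l.1, l.2))) _ _ (sigma_of_preimage _ B)).
Qed.

Lemma migration_popsum_independent n z c :
  independent_elements P (M n z) (popsum n c).
Proof.
move=> A B.
pose LA : set (mbpm_label p) := [set inr (n, z)].
pose LB : set (mbpm_label p) := fun m =>
  if m is inl (inr (k, j, i)) then k = n else False.
apply: (@disjoint_labels_independent LA LB).
- by rewrite -subset0 => m []; rewrite /LA /= => ->.
- exact: (@label_sub LA (inr (n, z)) _ _ (sigma_of_preimage _ A)).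
have /sigma_ofP : sigma_of (popsum n c) `<=` <<s cyl LB >>; last exact.
rewrite (_ : popsum n c = fun w => \sum_(k <- individuals c) X n k.1 k.2 w); last first.
  by apply/funext => w; rewrite popsumE.
by apply: offspring_sum_sigma.
Qed.

Lemma integral_step n z (phi : 'cV[nat]_p -> \bar R) :
  (forall b, 0 <= phi b)%E ->
  (\int[P]_w phi (step n z w) =
   \int[P]_w \int[P]_w' phi (popsum n (reproducing z (M n z w)) w'))%E.
Proof.
move=> phi0; apply: (@integral_freeze _ _ _ P 'cV[int]_p 'cV[nat]_p (M n z)
  (fun m => popsum n (reproducing z m)) (fun _ b => phi b)) => //.
- exact: (mbpm_M_random model).
- by move=> m; exact: popsum_random.
- by move=> m; exact: migration_popsum_independent.
Qed.

End one_step.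

(** * Moments and lower tail of the height after one generation *)

Section one_step_moments.
Context {d : measure_display} {T : measurableType d} {R : realType}.
Variables (P : probability T R) (p : nat).
Variables (Z0 : T -> 'cV[nat]_p) (X : nat -> nat -> 'I_p -> T -> 'cV[nat]_p)
  (Dm Im : nat -> 'cV[nat]_p -> T -> 'cV[nat]_p)
  (M : nat -> 'cV[nat]_p -> T -> 'cV[int]_p) (pz qz rz : 'cV[nat]_p -> 'I_p -> R).
Hypothesis model : is_mbpm P Z0 X Dm Im M pz qz rz.
Hypothesis X_L2 : forall i, square_integrable P (fun w => vec_nat (X 0%N 0%N i w)).
Variable u : 'cV[R]_p.
Hypothesis u_gt0 : forall i, 0 < u i 0.
Hypothesis u_left : u^T *m offspring_mean P X = u^T.

Definition height (z : 'cV[nat]_p) : R := dot u (vec_nat z).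

Lemma heightE z : height z = \sum_i u i 0 * (z i 0)%:R.
Proof. by rewrite /height dotE; apply: eq_bigr => i _; rewrite mxE. Qed.

Lemma height0 : height 0 = 0.
Proof. by rewrite heightE big1// => i _; rewrite mxE mulr0. Qed.

Lemma heightD a b : height (a + b) = height a + height b.
Proof.
rewrite !heightE -big_split; apply: eq_bigr => i _.
by rewrite mxE natrD mulrDr.
Qed.

Lemma height_ge0 a : 0 <= height a.
Proof. by rewrite heightE sumr_ge0// => i _; rewrite mulr_ge0// ltW. Qed.

Definition offspring_var i : R := dot u (offspring_cov P X i *m u).

(** The offspring means are the columns of [offspring_mean], so this is coordinate i of the
    eigenvector equation. Reproduction thus preserves the mean height, and only migration
    contributes to the drift. *)
Lemma offspring_mean_left i :
  dot u (mean_vec P (fun w => vec_nat (X 0%N 0%N i w))) = u i 0.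
Proof.
have /matrixP/(_ 0 i) := u_left; rewrite !mxE => <-.
by rewrite dotE; apply: eq_bigr => l _; rewrite !mxE.
Qed.

Lemma offspring_integral n j i (psi : 'cV[nat]_p -> \bar R) :
  (forall a, 0 <= psi a)%E ->
  (\int[P]_w psi (X n j i w) = \int[P]_w psi (X 0%N 0%N i w))%E.
Proof.
move=> psi0; apply: same_law_integral => //; try exact: (mbpm_X_random model).
exact: (mbpm_X_law model).
Qed.

Lemma offspring_height_mean n (k : nat * 'I_p) :
  (\int[P]_w (height (X n k.1 k.2 w))%:E)%E = (u k.2 0)%:E.
Proof.
rewrite (@offspring_integral n k.1 k.2 (fun a => (height a)%:E)).
  by have [_ ->] := has_mean_dot u (X_L2 k.2); rewrite offspring_mean_left.
by move=> a; rewrite lee_fin height_ge0.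
Qed.

Lemma offspring_height_var n (k : nat * 'I_p) c :
  (\int[P]_w ((height (X n k.1 k.2 w) - c) ^+ 2)%:E)%E =
  (offspring_var k.2 + (u k.2 0 - c) ^+ 2)%:E.
Proof.
rewrite (@offspring_integral n k.1 k.2 (fun a => ((height a - c) ^+ 2)%:E)).
  by have [_ ->] := has_mean_dot_dev u (X_L2 k.2) c; rewrite offspring_mean_left.
by move=> a; rewrite lee_fin sqr_ge0.
Qed.

Lemma sum_individuals_const (f : 'I_p -> R) c :
  \sum_(k <- individuals c) f k.2 = \sum_i (c i 0)%:R * f i.
Proof.
rewrite (sum_individuals c (fun _ i => f i)); apply: eq_bigr => i _.
by rewrite sumr_const card_ord mulr_natl.
Qed.

Lemma sum_individuals_height c : \sum_(k <- individuals c) u k.2 0 = height c.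
Proof.
rewrite (sum_individuals_const (fun i => u i 0)) heightE.
by apply: eq_bigr => i _; rewrite mulrC.
Qed.

(** By [popsum_var], the variance of the height of the offspring of c; averaged over the migration
    it becomes the offspring part of [sigma2]. *)
Definition spread (c : 'cV[nat]_p) : R := \sum_i (c i 0)%:R * offspring_var i.

Lemma offspring_var_ge0 i : 0 <= offspring_var i.
Proof. exact: (tau_ge0 (offspring_height_var 0) (0%N, i)). Qed.

Lemma spread_ge0 c : 0 <= spread c.
Proof.
by rewrite sumr_ge0// => i _; rewrite mulr_ge0// offspring_var_ge0.
Qed.

Let rX n (k : nat * 'I_p) : random_element (X n k.1 k.2).
Proof. exact: (mbpm_X_random model). Qed.

Lemma popsum_mean n c : (\int[P]_w (height (popsum X n c w))%:E)%E = (height c)%:E.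
Proof.
under eq_integral do rewrite popsumE.
rewrite (sum_mean (rX (n := n)) height0 heightD height_ge0
  (offspring_height_mean n) (individuals_uniq c)).
by rewrite sum_individuals_height.
Qed.

Lemma popsum_var n c a :
  (\int[P]_w ((height (popsum X n c w) - a) ^+ 2)%:E)%E =
  (spread c + (height c - a) ^+ 2)%:E.
Proof.
under eq_integral do rewrite popsumE.
rewrite (sum_var (rX (n := n)) (fun l s => offspring_independent model n (l := l) (s := s)) height0 heightD
  (offspring_height_var n) a (individuals_uniq c)).
by rewrite sum_individuals_height sum_individuals_const.
Qed.

Lemma popsum_lower_tail n c a t : 0 <= t ->
  (P [set w | (height (popsum X n c w) <= a)%R] <=
   (expR (t * a + (t ^+ 2 * (\sum_i (c i 0)%:R * (offspring_var i + u i 0 ^+ 2))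
     - t * height c)))%:E)%E.
Proof.
move=> t0.
rewrite (_ : [set w | _] =
    [set w | height (\sum_(k <- individuals c) X n k.1 k.2 w) <= a]); last first.
  by apply/seteqP; split => w /=; rewrite popsumE.
have := sum_lower_tail (rX (n := n)) (fun l s => offspring_independent model n (l := l) (s := s))
  height0 heightD height_ge0 (offspring_height_mean n) (offspring_height_var n)
  a t0 (individuals_uniq c).
by rewrite sum_individuals_height
  (sum_individuals_const (fun i => offspring_var i + u i 0 ^+ 2)).
Qed.

Lemma popsum_degenerate n c a : spread c = 0 -> a < height c ->
  P [set w | (height (popsum X n c w) <= a)%R] = 0%E.
Proof.
move=> sc ac.
rewrite (_ : [set w | _] =
    [set w | height (\sum_(k <- individuals c) X n k.1 k.2 w) <= a]); last first.
  by apply/seteqP; split => w /=; rewrite popsumE.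
apply: (sum_degenerate (rX (n := n)) (fun l s => offspring_independent model n (l := l) (s := s))
  height0 heightD (offspring_height_var n) (individuals_uniq c)).
  by rewrite sum_individuals_const.
by rewrite sum_individuals_height.
Qed.

Variables (alpha : R) (alpha0 : 0 < alpha).

Lemma popsum_measurable n c (psi : 'cV[nat]_p -> \bar R) :
  measurable_fun setT (fun w => psi (popsum X n c w)).
Proof. exact: (measurable_fun_countable psi (popsum_random model (n := n) (c := c))). Qed.

Lemma popsum_lyap n c x a : 0 <= a -> a <= x ->
  (\int[P]_w (lyap alpha (height (popsum X n c w)))%:E <=
   (lyap alpha x - alpha * slope alpha x * (height c - x)
    + alpha * curv alpha a / 2 * (spread c + (height c - x) ^+ 2))%:E
   + P [set w | (height (popsum X n c w) <= a)%R])%E.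
Proof.
move=> a0 ax; have x0 := le_trans a0 ax.
set S := fun w => height (popsum X n c w).
have S0 w : 0 <= S w by exact: height_ge0.
set A := [set w | _].
have mA : measurable A.
  exact: (random_element_preimage [set b | height b <= a]
    (popsum_random model (n := n) (c := c))).
set s := alpha * slope alpha x; set k := alpha * curv alpha a / 2.
have s0 : 0 <= s by apply: mulr_ge0; apply: ltW => //; exact: slope_gt0.
have k0 : 0 <= k by apply: divr_ge0 => //; apply: mulr_ge0; apply: ltW => //; exact: curv_gt0.
have mS (psi : R -> \bar R) : measurable_fun setT (psi \o S).
  exact: (popsum_measurable n c (psi \o height)).
have mI : measurable_fun setT (fun w => (\1_A w : R)%:E).
  by apply/measurable_EFinP; exact: measurable_indic.
have L0 w : (0 <= (lyap alpha (S w))%:E)%E by rewrite lee_fin powR_ge0.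
(* Again the linear term is moved so that all integrands are nonnegative. Above a this is Taylor's
   bound; on A one has [S w <= a <= x], so [s * (x - S w)] is nonnegative and the indicator pays for
   [lyap <= 1]. *)
have : (\int[P]_w ((lyap alpha (S w))%:E + s%:E * (S w)%:E) <=
    \int[P]_w ((lyap alpha x + s * x)%:E +
     (k%:E * ((S w - x) ^+ 2)%:E + (\1_A w)%:E)))%E.
  apply: ge0_le_integral => //.
  - by move=> w _; rewrite adde_ge0// mule_ge0// lee_fin.
  - exact: (mS (fun r => (lyap alpha r)%:E + s%:E * r%:E)%E).
  - apply: emeasurable_funD; first exact: measurable_cst.
    apply: emeasurable_funD => //.
    exact: (mS (fun r => k%:E * ((r - x) ^+ 2)%:E)%E).
  - move=> w _; rewrite -!EFinM -!EFinD lee_fin indicE.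
    case: (boolP (w \in A)) => wA /=.
      move: wA; rewrite inE /A /= => Sa.
      have := lyap_le1 alpha0 (S0 w); have := lyap_gt0 alpha x0.
      have : 0 <= s * (x - S w) by rewrite mulr_ge0// subr_ge0 (le_trans Sa).
      have : 0 <= k * (S w - x) ^+ 2 by rewrite mulr_ge0// sqr_ge0.
      by lra.
    have Sa : a <= S w.
      by move: wA; rewrite notin_setE /A /= => /negP; rewrite -ltNge => /ltW.
    by have := lyap_taylor alpha0 a0 ax Sa; rewrite -/s -/k; lra.
rewrite ge0_integralD//; try by [move=> w _; rewrite mule_ge0// lee_fin|
  exact: (mS (fun r => (lyap alpha r)%:E))|exact: (mS (fun r => s%:E * r%:E)%E)].
rewrite ge0_integralD//; try by [
   move=> w _; rewrite adde_ge0// ?mule_ge0// lee_fin ?sqr_ge0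
  |apply: emeasurable_funD => //; exact: (mS (fun r => k%:E * ((r - x) ^+ 2)%:E)%E)
  |move=> w _; rewrite lee_fin addr_ge0 ?powR_ge0// mulr_ge0].
rewrite ge0_integralD//; try by [
   move=> w _; rewrite ?mule_ge0// lee_fin ?sqr_ge0
  |exact: (mS (fun r => k%:E * ((r - x) ^+ 2)%:E)%E)].
rewrite !ge0_integralZl//; try by [
   move=> w _; rewrite ?mule_ge0// lee_fin ?sqr_ge0
  |exact: (mS (fun r => ((r - x) ^+ 2)%:E)%E)|exact: (mS EFin)].
rewrite popsum_mean popsum_var integral_indic// setIT integral_probability_cst.
rewrite -!EFinM addeA -EFinD.
rewrite -leeBrDr// => /le_trans; apply.
rewrite addeAC -EFinB leeD2r// lee_fin; lra.
Qed.

End one_step_moments.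

(** * Drift of the Lyapunov function *)

Section drift.
Context {d : measure_display} {T : measurableType d} {R : realType}.
Variables (P : probability T R) (p : nat).
Variables (Z0 : T -> 'cV[nat]_p) (X : nat -> nat -> 'I_p -> T -> 'cV[nat]_p)
  (Dm Im : nat -> 'cV[nat]_p -> T -> 'cV[nat]_p)
  (M : nat -> 'cV[nat]_p -> T -> 'cV[int]_p) (pz qz rz : 'cV[nat]_p -> 'I_p -> R).
Hypothesis model : is_mbpm P Z0 X Dm Im M pz qz rz.
Hypothesis X_L2 : forall i, square_integrable P (fun w => vec_nat (X 0%N 0%N i w)).
Hypothesis M_L2 : forall z, square_integrable P (fun w => vec_int (M 0%N z w)).
Variable u : 'cV[R]_p.
Hypothesis u_gt0 : forall i, 0 < u i 0.
Hypothesis u_left : u^T *m offspring_mean P X = u^T.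
Hypothesis u_sum : \sum_(i < p) u i 0 = 1.

Local Notation height := (height u).
Local Notation tau := (offspring_var P X u).
Local Notation spread := (spread P X u).
Local Notation mig z := (migration_mean P M z).

(** The reciprocal of a sum of reciprocals replaces the least nonzero value; the zeros do not
    disturb it since [0^-1 = 0]. *)
Lemma gap_of_nonneg (I : finType) (f : I -> R) : (forall i, 0 <= f i) ->
  exists2 e, 0 < e & forall i, f i = 0 \/ e <= f i.
Proof.
move=> f0; have s0 : 0 <= \sum_i (f i)^-1 by rewrite sumr_ge0// => i _; rewrite invr_ge0.
have s1 : 0 < 1 + \sum_i (f i)^-1 by rewrite ltr_pwDl.
exists (1 + \sum_i (f i)^-1)^-1; first by rewrite invr_gt0.
move=> i; have [->|fi] := eqVneq (f i) 0; [by left|right].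
have fi0 : 0 < f i by rewrite lt_neqAle eq_sym fi f0.
rewrite -[leRHS]invrK lef_pV2 ?posrE ?invr_gt0//.
rewrite (bigD1 i)//= addrCA lerDl addr_ge0// sumr_ge0// => j _.
by rewrite invr_ge0.
Qed.

Definition offspring_second i : R := tau i + u i 0 ^+ 2.

Lemma offspring_second_ge0 i : 0 <= offspring_second i.
Proof.
by rewrite addr_ge0 ?sqr_ge0// (offspring_var_ge0 model X_L2 u_left).
Qed.

(** The factor [spread c] matters: averaged over the migration it is bounded by [sigma2], hence
    through the drift, while a bare exponential could not be compared with a drift that has no lower
    bound of its own. The factor is affordable because [spread c] is either 0, when the sum is
    almost surely constant, or at least the gap e. *)
Lemma popsum_tail (q b C : R) : q < b -> 0 < C ->
  exists kappa theta, [/\ 0 < kappa, 0 < theta & forall n c x, 0 < x ->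
    b * x <= height c -> \sum_i (c i 0)%:R * offspring_second i <= C * x ->
    (P [set w | (height (popsum X n c w) <= q * x)%R] <=
      (theta * expR (- (kappa * x)) * spread c)%:E)%E].
Proof.
move=> qb C0.
have tau0 i : 0 <= tau i by exact: (offspring_var_ge0 model X_L2 u_left).
have [e e0 He] := gap_of_nonneg tau0.
exists ((b - q) ^+ 2 / (4 * C)), e^-1.
have bq : 0 < b - q by rewrite subr_gt0.
split; [by rewrite divr_gt0 ?exprn_gt0 ?mulr_gt0|by rewrite invr_gt0|].
move=> n c x x0 bx sC.
have [sc|sc] := eqVneq (spread c) 0.
  rewrite (popsum_degenerate model X_L2 u_left)//; last first.
    by apply: lt_le_trans bx; rewrite ltr_pM2r.
  by rewrite sc mulr0.
have es : 1 <= e^-1 * spread c.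
  rewrite ler_pdivlMl// mulr1.
  have [i ci] : exists i, (c i 0)%:R * tau i != 0.
    apply/existsP; apply: contraT; rewrite negb_exists => /forallP h.
    by case/negP: sc; apply/eqP; rewrite /spread big1// => i _; apply/eqP;
      have := h i; rewrite negbK.
  rewrite /spread (bigD1 i)//= (le_trans (_ : e <= (c i 0)%:R * tau i))//; last first.
    by rewrite lerDl sumr_ge0// => j _; rewrite mulr_ge0.
  have := ci; rewrite mulf_eq0 negb_or pnatr_eq0 -lt0n => /andP[c0 t0].
  have [ti|ti] := He i; first by rewrite ti eqxx in t0.
  by rewrite (le_trans ti)// ler_peMl// ler1n.
(* The minimiser of the exponent [(C * t ^+ 2 - (b - q) * t) * x], with minimum
   [- (b - q) ^+ 2 / (4 * C) * x]. *)
pose t := (b - q) / (2 * C).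
have t0 : 0 <= t by rewrite divr_ge0 ?ltW// mulr_gt0.
apply: (le_trans (popsum_lower_tail model X_L2 u_gt0 u_left _ _ _ t0)).
rewrite lee_fin; apply: (@le_trans _ _ (expR (- ((b - q) ^+ 2 / (4 * C) * x)))).
  rewrite ler_expR.
  have h1 := ler_wpM2l t0 bx; have h2 := ler_wpM2l (sqr_ge0 t) sC.
  apply: (@le_trans _ _ (t * (q * x) + (t ^+ 2 * (C * x) - t * (b * x)))).
    by rewrite lerD2l lerB.
  rewrite le_eqVlt; apply/orP; left; apply/eqP; rewrite /t; field.
  by rewrite lt0r_neq0.
rewrite [leRHS]mulrAC -[leLHS]mul1r ler_wpM2r ?expR_ge0//.
Qed.

Lemma sigma2E z : sigma2 P X M u z =
  \sum_i ((z i 0)%:R + mig z i 0) * tau i + dot u (migration_cov P M z *m u).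
Proof.
rewrite /sigma2 mulmxDl /dot mulmxDr mxE; congr (_ + _).
rewrite mulmx_suml mulmx_sumr summxE; apply: eq_bigr => i _.
by rewrite -scalemxAl -scalemxAr mxE.
Qed.

Lemma migration_var_ge0 z : 0 <= dot u (migration_cov P M z *m u).
Proof.
have [_ E] := has_mean_dot_dev u (M_L2 z) (dot u (mig z)).
move: E; rewrite subrr expr0n addr0 => E.
by rewrite -lee_fin -E; apply: integral_ge0 => w _; rewrite lee_fin sqr_ge0.
Qed.

Lemma has_mean_migration (z : 'cV[nat]_p) i :
  has_mean P (fun w => (M 0%N z w i 0)%:~R) (mig z i 0).
Proof. by apply: has_mean_ext (has_mean_coord (M_L2 z) i) _ _ => // w; rewrite mxE. Qed.

Lemma reproducing_mean_ge0 (z : 'cV[nat]_p) i : 0 <= (z i 0)%:R + mig z i 0.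
Proof.
have [_ E] := has_meanD (has_mean_cst P (z i 0)%:R) (has_mean_migration z i).
rewrite -lee_fin -E; apply: integral_ge0 => w _; rewrite lee_fin.
have := mbpm_M_range model 0%N z w i; rewrite -(ler_int R) rmorphN /=.
by rewrite addrC -lerBlDr sub0r.
Qed.

Lemma sigma2_ge0 z : 0 <= sigma2 P X M u z.
Proof.
rewrite sigma2E addr_ge0 ?migration_var_ge0// sumr_ge0// => i _.
by rewrite mulr_ge0 ?reproducing_mean_ge0// (offspring_var_ge0 model X_L2 u_left).
Qed.

Section fixed_state.
Variables (alpha : R) (alpha0 : 0 < alpha).
Variables (z : 'cV[nat]_p) (q : R).
Hypothesis q01 : 0 < q < 1.

Local Notation x := (height z).
Local Notation h := (dot u (mig z)).
(** Half of the gap between q and 1: jumps up to [e * x] leave the reproducing population at height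
    [(1 + q) / 2 * x] or more, and the other half separates this from [q * x]. *)
Let e := (1 - q) / 2.
(** Without a big jump at most [((u i 0)^-1 + 2) * x] individuals of type i reproduce: [z i 0] is at
    most [(u i 0)^-1 * x], and the mean migration and its deviation add at most x each. The leading
    1 keeps the constant positive. *)
Definition tail_const : R := 1 + \sum_i ((u i 0)^-1 + 2) * offspring_second i.

Lemma tail_const_gt0 : 0 < tail_const.
Proof.
rewrite ltr_pwDl// sumr_ge0// => i _.
by rewrite mulr_ge0 ?offspring_second_ge0// addr_ge0// invr_ge0 ltW.
Qed.

Hypothesis x_gt0 : 0 < x.
Hypothesis h_ge0 : 0 <= h.
Hypothesis mig_le : forall i, `|mig z i 0| <= x.

Definition big_jump i : set 'cV[int]_p :=
  [set m | e * x < `|(m i 0)%:~R - mig z i 0|].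

Lemma reproducingE (m : 'cV[int]_p) i : - (z i 0)%:Z <= m i 0 ->
  (reproducing z m i 0)%:R = (z i 0)%:R + (m i 0)%:~R :> R.
Proof.
move=> zm; rewrite mxE [LHS]pmulrn gez0_abs; last by rewrite -lerBlDl sub0r.
by rewrite rmorphD.
Qed.

Lemma height_reproducing (m : 'cV[int]_p) :
  (forall i, - (z i 0)%:Z <= m i 0) ->
  height (reproducing z m) = x + dot u (vec_int m).
Proof.
move=> zm; rewrite !heightE dotE -big_split; apply: eq_bigr => i _ /=.
by rewrite reproducingE// mulrDr; congr (_ + _ * _); rewrite mxE.
Qed.

Lemma good_migration (m : 'cV[int]_p) : (forall i, - (z i 0)%:Z <= m i 0) ->
  (forall i, ~ big_jump i m) ->
  (1 + q) / 2 * x <= height (reproducing z m) /\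
  \sum_i (reproducing z m i 0)%:R * offspring_second i <= tail_const * x.
Proof.
move=> zm mgood; have /andP[q0 q1] := q01.
have good i : `|(m i 0)%:~R - mig z i 0| <= e * x.
  by have /negP := mgood i; rewrite -leNgt.
split.
  rewrite height_reproducing//.
  (* The weights u sum to 1, so deviations of at most [e * x] in each coordinate cost at most
     [e * x] in height. *)
  have : h - e * x <= dot u (vec_int m).
    rewrite !dotE -[e * x]mul1r -u_sum mulr_suml -sumrB ler_sum// => i _.
    rewrite [vec_int m i 0]mxE -mulrBr ler_pM2l//.
    by have := good i; rewrite ler_norml => /andP[+ _]; lra.
  by rewrite /e => H; have := h_ge0; lra.
rewrite /tail_const mulrDl mul1r mulr_suml -[leLHS]add0r lerD ?(ltW x_gt0)//.
apply: ler_sum => i _; rewrite mulrAC ler_wpM2r ?offspring_second_ge0//.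
rewrite reproducingE// mulrDl.
have zi : (z i 0)%:R <= (u i 0)^-1 * x.
  rewrite ler_pdivlMl// heightE (bigD1 i)//= lerDl sumr_ge0// => j _.
  by rewrite mulr_ge0// ltW.
have := good i; rewrite ler_norml => /andP[_ g2].
have := mig_le i; rewrite ler_norml => /andP[_ g3].
have : e * x <= x by rewrite ler_piMl ?(ltW x_gt0)// /e; lra.
by lra.
Qed.

Lemma step_lyap_le kappa theta : 0 < kappa -> 0 < theta ->
  (forall n c x, 0 < x -> (1 + q) / 2 * x <= height c ->
    \sum_i (c i 0)%:R * offspring_second i <= tail_const * x ->
    (P [set w | (height (popsum X n c w) <= q * x)%R] <=
      (theta * expR (- (kappa * x)) * spread c)%:E)%E) ->
  forall n, (\int[P]_w (lyap alpha (height (step X M n z w)))%:E <=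
   (lyap alpha x - alpha * slope alpha x * h
    + alpha * curv alpha (q * x) / 2 * (sigma2 P X M u z + h ^+ 2)
    + theta * expR (- (kappa * x)) * sigma2 P X M u z
    + \sum_i fine (P [set w | big_jump i (M 0%N z w)]))%:E)%E.
Proof.
move=> kappa0 theta0 tailP n; have /andP[q0 q1] := q01.
set s := alpha * slope alpha x; set k := alpha * curv alpha (q * x) / 2.
set th := theta * expR (- (kappa * x)).
have th0 : 0 <= th by rewrite mulr_ge0 ?expR_ge0// ltW.
have qx0 : 0 <= q * x by rewrite mulr_ge0// ltW.
have qx : q * x <= x by rewrite ler_piMl// ltW.
pose V := dot u (migration_cov P M z *m u).
pose Sp := \sum_i ((z i 0)%:R + mig z i 0) * tau i.
have sE : sigma2 P X M u z = Sp + V by exact: sigma2E.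
pose psi (m : 'cV[int]_p) := (\int[P]_w (lyap alpha (height (popsum X n (reproducing z m) w)))%:E)%E.
have psi0 m : (0 <= psi m)%E.
  by apply: integral_ge0 => w _; rewrite lee_fin powR_ge0.
pose dm (m : 'cV[int]_p) : R := dot u (vec_int m).
pose sp (m : 'cV[int]_p) : R := \sum_i ((z i 0)%:R + (m i 0)%:~R) * tau i.
pose J (m : 'cV[int]_p) : R := \sum_i \1_(big_jump i) m.
(* The migration is frozen at m and averaged afterwards: [dm] has mean h, and [sp + dm ^+ 2] has
   mean [sigma2 + h ^+ 2]. On a big jump [J m] is at least 1 and covers any probability; otherwise
   the offspring tail [th * sp m] applies. *)
pose Phi m := lyap alpha x + (- s) * dm m + k * (sp m + dm m ^+ 2) + th * sp m + J m.
have psiPhi (m : 'cV[int]_p) : (forall i, - (z i 0)%:Z <= m i 0) -> (psi m <= (Phi m)%:E)%E.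
  move=> zm; have := popsum_lyap model X_L2 u_gt0 u_left alpha0 n
    (reproducing z m) qx0 qx.
  have hE : height (reproducing z m) - x = dm m.
    by rewrite height_reproducing// addrAC subrr add0r.
  move=> /le_trans; apply; rewrite hE.
  have spE : spread (reproducing z m) = sp m.
    by apply: eq_bigr => i _; rewrite reproducingE.
  have sp0 : 0 <= sp m by rewrite -spE (spread_ge0 model X_L2 u_left).
  have J0 : 0 <= J m by rewrite sumr_ge0.
  have : (P [set w | (height (popsum X n (reproducing z m) w) <= q * x)%R] <=
     (th * sp m + J m)%:E)%E.
    have [[i jm]|good] := pselect (exists i, big_jump i m).
      rewrite (le_trans (probability_le1 _ _))//.
        exact: (random_element_preimage [set b | height b <= q * x]
          (popsum_random model (n := n) (c := reproducing z m))).
      rewrite lee_fin /J (bigD1 i)//= indicE mem_set// addrCA lerDl.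
      by apply: addr_ge0; [exact: mulr_ge0|exact: sumr_ge0].
    have {}good i : ~ big_jump i m by move=> jm; apply: good; exists i.
    have [g1 g2] := good_migration zm good.
    rewrite (le_trans (tailP n _ _ x_gt0 g1 g2))// lee_fin spE -/th.
    by rewrite lerDl.
  move=> /(leeD2l _) /le_trans; apply.
  by rewrite -EFinD lee_fin spE /Phi -/(dm m) -/s -/k; lra.
rewrite (integral_step model n z (phi := fun b => (lyap alpha (height b))%:E)); last first.
  by move=> b; rewrite lee_fin powR_ge0.
rewrite -/(psi _).
rewrite (@same_law_integral _ _ _ P 'cV[int]_p (M n z) (M 0%N z) psi)//; last 3 first.
- exact: (mbpm_M_random model).
- exact: (mbpm_M_random model).
- exact: (mbpm_M_law model).
have rM : random_element (M 0%N z) by exact: (mbpm_M_random model).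
have mM := has_mean_migration z.
have msp : has_mean P (fun w => sp (M 0%N z w)) Sp.
  apply: has_mean_ext (has_mean_sum (index_enum _) (fun i =>
    has_meanZ (tau i) (has_meanD (has_mean_cst P (z i 0)%:R) (mM i)))) _ _ => [w|];
  by apply: eq_bigr => i _; rewrite mulrC.
have mdm := has_mean_dot u (M_L2 z).
have mdm2 := has_mean_dot2 u (M_L2 z).
have mJi i : has_mean P (fun w => \1_(big_jump i) (M 0%N z w) : R)
    (fine (P [set w | big_jump i (M 0%N z w)])).
  have mi := random_element_preimage (big_jump i) rM.
  exact: has_mean_ext (has_mean_indic P mi) _ _.
have mJ : has_mean P (fun w => J (M 0%N z w))
    (\sum_i fine (P [set w | big_jump i (M 0%N z w)])).
  exact: has_mean_sum mJi.
have mPhi : has_mean P (fun w => Phi (M 0%N z w)) (lyap alpha x + (- s) * h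
    + k * (Sp + (V + h ^+ 2)) + th * Sp + \sum_i fine (P [set w | big_jump i (M 0%N z w)])).
  apply: has_meanD mJ; apply: has_meanD (has_meanZ th msp).
  apply: has_meanD (has_meanZ k (has_meanD msp mdm2)).
  exact: has_meanD (has_mean_cst P _) (has_meanZ (- s) mdm).
have V0 : 0 <= V := migration_var_ge0 z.
apply: (@le_trans _ _ (\int[P]_w (Phi (M 0%N z w))%:E)%E).
  apply: ge0_le_integral => //.
  - exact: (measurable_fun_countable psi rM).
  - exact: (measurable_fun_countable (EFin \o Phi) rM).
  - by move=> w _; apply: psiPhi => i; exact: (mbpm_M_range model).
have [_ ->] := mPhi; rewrite lee_fin sE lerD2r.
have : th * Sp <= th * (Sp + V) by rewrite ler_wpM2l// lerDl.
by lra.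
Qed.

End fixed_state.
End drift.

(** * Negative drift at large heights *)

Section lyapunov_drift.
Context {d : measure_display} {T : measurableType d} {R : realType}.
Variables (P : probability T R) (p : nat) (p_gt0 : (0 < p)%N).
Variables (Z0 : T -> 'cV[nat]_p) (X : nat -> nat -> 'I_p -> T -> 'cV[nat]_p)
  (Dm Im : nat -> 'cV[nat]_p -> T -> 'cV[nat]_p)
  (M : nat -> 'cV[nat]_p -> T -> 'cV[int]_p) (pz qz rz : 'cV[nat]_p -> 'I_p -> R).
Hypothesis model : is_mbpm P Z0 X Dm Im M pz qz rz.
Hypothesis X_L2 : forall i, square_integrable P (fun w => vec_nat (X 0%N 0%N i w)).
Hypothesis M_L2 : forall z, square_integrable P (fun w => vec_int (M 0%N z w)).
Variable u : 'cV[R]_p.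
Hypothesis u_gt0 : forall i, 0 < u i 0.
Hypothesis u_left : u^T *m offspring_mean P X = u^T.
Hypothesis u_sum : \sum_(i < p) u i 0 = 1.
Variables (alpha delta c : R).
Hypotheses (alpha0 : 0 < alpha) (delta0 : 0 < delta) (c1 : 1 < c).

Local Notation height := (height u).
Local Notation mig z := (migration_mean P M z).

Hypothesis mig_small : forall e : R, 0 < e ->
  exists K, forall z, K <= height z -> forall i, `|mig z i 0| <= e * height z.
Hypothesis mig_large : exists K, forall z, K <= height z ->
  0 < dot u (mig z) /\ c * sigma2 P X M u z <= 2 * height z * dot u (mig z).
Hypothesis mig_moment : forall e : R, 0 < e ->
  exists K, forall z, K <= height z -> forall i,
  (\int[P]_w (`|(M 0%N z w i 0)%:~R - mig z i 0| `^ (2 + delta))%:E <=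
    (e * (height z `^ (1 + delta) * dot u (mig z)
          / ln (height z) `^ (1 + alpha)))%:E)%E.

Lemma markov_powR (f : T -> R) (a r : R) : measurable_fun setT f -> 0 < a -> 0 <= r ->
  (P [set w | (a < `|f w|)%R] * (a `^ r)%:E <= \int[P]_w (`|f w| `^ r)%:E)%E.
Proof.
move=> mf a0 r0; set A := [set w | _].
have mn : measurable_fun setT (fun w => `|f w|).
  by apply: measurableT_comp.
have mA : measurable A.
  have := mn measurableT _ (measurable_itv `]a, +oo[); rewrite setTI.
  by congr (measurable _); apply/seteqP; split => w /=; rewrite in_itv /= andbT.
have ar0 : 0 <= a `^ r by rewrite powR_ge0.
have mI : measurable_fun setT (fun w => (\1_A w : R)%:E).
  by apply/measurable_EFinP; exact: measurable_indic.
rewrite muleC -(setIT A) -integral_indic// -ge0_integralZl//.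
apply: ge0_le_integral => //.
- by move=> w _; rewrite mule_ge0// lee_fin.
- exact: (emeasurable_funM (measurable_cst _) mI).
- apply/measurable_EFinP.
  exact: (measurableT_comp (@measurable_powR R r) mn).
move=> w _; rewrite -EFinM lee_fin indicE.
case: (boolP (w \in A)) => wA /=; last by rewrite mulr0 powR_ge0.
rewrite mulr1; move: wA; rewrite inE /A /= => wA.
by apply: ge0_ler_powR => //; rewrite ?nnegrE// ltW.
Qed.

(** In Markov's inequality at the power [2 + delta], the power of b put into the assumed bound
    cancels the one in the denominator, and the powers of the height leave its inverse. *)
Lemma big_jump_le (e b : R) z i : 0 < e -> 0 < b -> 0 < height z ->
  0 < ln (height z) ->
  (\int[P]_w (`|(M 0%N z w i 0)%:~R - mig z i 0| `^ (2 + delta))%:E <=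
    (e * b `^ (2 + delta) * (height z `^ (1 + delta) * dot u (mig z)
          / ln (height z) `^ (1 + alpha)))%:E)%E ->
  fine (P [set w | b * height z < `|(M 0%N z w i 0)%:~R - mig z i 0|]) <=
  e * dot u (mig z) * ((height z)^-1 / ln (height z) `^ (1 + alpha)).
Proof.
move=> e0 b0 x0 lx0 mom; set x := height z in x0 lx0 mom *.
have rM : random_element (M 0%N z) by exact: (mbpm_M_random model).
set f := fun w => (M 0%N z w i 0)%:~R - mig z i 0.
have mf : measurable_fun setT f.
  exact: (measurable_fun_countable (fun m : 'cV[int]_p => (m i 0)%:~R - mig z i 0 : R) rM).
have bx0 : 0 < b * x by rewrite mulr_gt0.
have r0 : 0 <= 2 + delta by rewrite addr_ge0// ltW.
have := le_trans (markov_powR mf bx0 r0) mom.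
set A := [set w | _].
have mA : measurable A.
  exact: (random_element_preimage [set m : 'cV[int]_p |
     b * x < `|(m i 0)%:~R - mig z i 0|] rM).
rewrite -[P A]fineK ?fin_num_measure// -EFinM lee_fin.
rewrite -ler_pdivlMr ?powR_gt0// => /le_trans; apply.
rewrite le_eqVlt; apply/orP; left; apply/eqP.
rewrite powRM ?(ltW b0) ?(ltW x0)//.
rewrite (_ : x `^ (2 + delta) = x `^ (1 + delta) * x); last first.
  rewrite (_ : 2 + delta = (1 + delta) + 1); last by ring.
  by rewrite powRD ?lt0r_neq0 ?implybT// powRr1// ltW.
field.
by rewrite !lt0r_neq0 ?powR_gt0.
Qed.

Lemma drift : exists K (gamma : 'cV[nat]_p -> R),
  (forall z, K <= height z -> 0 < gamma z) /\
  (forall n z, K <= height z ->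
    (\int[P]_w (lyap alpha (height (step X M n z w)))%:E + (gamma z)%:E
     <= (lyap alpha (height z))%:E)%E).
Proof.
(* In units of [alpha * slope alpha x * h], where h is the drift of the height, the losses are
   [(1 + eta) * (c^-1 + eta / 2)] from Taylor's bound, eta from the offspring tail and eta from the
   jumps; [rho / 2] is reserved for gamma. With this eta they total at most 1. *)
pose rho := 1 - c^-1; pose eta := rho / 8.
have c0 : 0 < c by exact: lt_trans c1.
have rho0 : 0 < rho by rewrite subr_gt0 invf_lt1.
have rho1 : rho < 1 by rewrite ltrBlDr ltrDl invr_gt0.
have eta0 : 0 < eta by rewrite divr_gt0.
have [q q01 [xc Hc]] := curv_le_slope alpha0 eta0.
have /andP[q0 q1] := q01.
have qb : q < (1 + q) / 2 by lra.
have [kappa [theta [kappa0 theta0 tailP]]] :=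
  popsum_tail model X_L2 u_gt0 u_left qb (tail_const_gt0 model X_L2 u_gt0 u_left).
have ae0 : 0 < alpha * eta by rewrite mulr_gt0.
(* The factor 2 anticipates the bound [2 * x * h] for [sigma2]. *)
have [xe He] := exp_negligible_slope alpha0 kappa0
   (divr_gt0 ae0 (mulr_gt0 (ltr0n R 2) theta0)).
have [C1 C10 [xl Hl]] := lnV_le_slope alpha0.
pose b := (1 - q) / 2.
have b0 : 0 < b by rewrite divr_gt0// subr_gt0.
(* The jump budget [alpha * eta] is shared among the p types, and C1 is the price of the comparison
   with [slope]. *)
pose e1 := alpha * eta / (C1 * p%:R).
have p0 : 0 < p%:R :> R by rewrite ltr0n.
have e10 : 0 < e1 by rewrite divr_gt0// mulr_gt0.
have [K1 H1] := mig_small eta0.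
have [K2 H2] := mig_large.
have [K3 H3] := mig_moment (mulr_gt0 e10 (powR_gt0 (2 + delta) b0)).
exists (\big[Num.max/1]_(k <- [:: xc; xe; xl; K1; K2; K3]) k),
  (fun z => alpha * slope alpha (height z) * dot u (mig z) * (rho / 2)).
have KP z : \big[Num.max/1]_(k <- [:: xc; xe; xl; K1; K2; K3]) k <= height z ->
  [/\ 1 <= height z, xc <= height z, xe <= height z, xl <= height z &
    [/\ K1 <= height z, K2 <= height z & K3 <= height z]].
  by rewrite !big_cons big_nil !ge_max => /and5P[-> -> -> -> /and3P[-> -> ->]].
split.
  move=> z /KP[x1 _ _ _ [_ /H2[h0 _] _]].
  have s0 : 0 < slope alpha (height z) by rewrite slope_gt0// (le_trans ler01).
  by apply: (mulr_gt0 (mulr_gt0 (mulr_gt0 alpha0 s0) h0)); rewrite divr_gt0.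
move=> n z /KP[x1 /Hc{}Hc /He{}He /Hl{}Hl [/H1{}H1 /H2[h0 H2'] /H3{}H3]].
set x := height z in x1 Hc He Hl H1 h0 H2' H3 *; set h := dot u (mig z) in h0 H2' H3 *.
have x0 : 0 < x by exact: lt_le_trans x1.
have {}Hc := Hc (ltW x0); have {}He := He (ltW x0); have [lx0 {}Hl] := Hl (ltW x0).
have migx i : `|mig z i 0| <= x.
  by rewrite (le_trans (H1 i))// ler_piMl ?(ltW x0)// /eta; lra.
have hx : h <= eta * x.
  rewrite /h dotE -[leRHS]mul1r -u_sum mulr_suml ler_sum// => i _.
  by rewrite ler_pM2l// (le_trans (ler_norm _)).
have := step_lyap_le model X_L2 M_L2 u_gt0 u_left u_sum alpha0 q01 x0 (ltW h0) migx
  kappa0 theta0 tailP n.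
move=> /(leeD2r (alpha * slope alpha x * h * (rho / 2))%:E) /le_trans; apply.
rewrite -EFinD lee_fin -/x -/h.
set s := slope alpha x; have s0 : 0 < s by rewrite slope_gt0// ltW.
set S2 := sigma2 P X M u z in H2' *.
have jumps : \sum_i fine (P [set w | big_jump P M u z q i (M 0%N z w)]) <=
    alpha * eta * s * h.
  rewrite (_ : alpha * eta * s * h = \sum_(i < p) e1 * h * (C1 * s)); last first.
    rewrite sumr_const card_ord -mulr_natl /e1; field.
    by rewrite !lt0r_neq0.
  apply: ler_sum => i _.
  rewrite (le_trans (big_jump_le e10 b0 x0 lx0 (H3 i)))//.
  by rewrite ler_wpM2l// mulr_ge0// ltW.
have ash : 0 < alpha * s * h := mulr_gt0 (mulr_gt0 alpha0 s0) h0.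
have curvT : alpha * curv alpha (q * x) / 2 * (S2 + h ^+ 2) <=
    alpha * s * h * ((1 + eta) * (c^-1 + eta / 2)).
  have S2h : S2 + h ^+ 2 <= x * h * (2 * c^-1 + eta).
    have S2c : S2 <= 2 * x * h / c by rewrite ler_pdivlMr// mulrC.
    have : h ^+ 2 <= eta * x * h by rewrite expr2 ler_wpM2r// ltW.
    by lra.
  have k0 : 0 <= alpha * curv alpha (q * x) / 2.
    apply: divr_ge0 => //; apply: mulr_ge0; apply: ltW => //.
    by apply: curv_gt0 => //; rewrite mulr_ge0// ltW.
  apply: (le_trans (ler_wpM2l k0 S2h)).
  have d0 : 0 <= 2 * c^-1 + eta by rewrite addr_ge0 ?(ltW eta0)// mulr_ge0// invr_ge0 ltW.
  have k1 : alpha * curv alpha (q * x) / 2 * x <= alpha * s * (1 + eta) / 2.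
    have : curv alpha (q * x) * x <= (1 + eta) * s.
      apply: (le_trans (ler_wpM2r (ltW x0) Hc)).
      rewrite -/s -mulrA ler_wpM2l ?addr_ge0 ?(ltW eta0)//.
      rewrite -mulrA ler_piMr ?(ltW s0)// mulrC ler_pdivrMr ?mul1r ?lerDr//.
      by rewrite ltr_pwDl// ltW.
    by move=> /(ler_wpM2l (ltW alpha0)); lra.
  have := ler_wpM2r (mulr_ge0 (ltW h0) d0) k1; lra.
have tailT : theta * expR (- (kappa * x)) * S2 <= alpha * s * h * eta.
  have t0 : 0 <= theta * expR (- (kappa * x)) by rewrite mulr_ge0 ?expR_ge0// ltW.
  have S2c : S2 <= 2 * x * h.
    have [S20|/ltW S20] := leP S2 0.
      by rewrite (le_trans S20)// !mulr_ge0// ltW.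
    by apply: le_trans H2'; rewrite ler_peMl// ltW.
  apply: (le_trans (ler_wpM2l t0 S2c)).
  have := ler_wpM2l (mulr_ge0 (mulr_ge0 (ltW theta0) (ler0n R 2)) (ltW h0)) He.
  rewrite (_ : theta * 2 * h * (_ * slope alpha x) = alpha * s * h * eta); last first.
    by rewrite -/s; field; rewrite lt0r_neq0.
  by apply: le_trans; rewrite le_eqVlt; apply/orP; left; apply/eqP; ring.
have final : (1 + eta) * (c^-1 + eta / 2) + 2 * eta + rho / 2 <= 1.
  have -> : c^-1 = 1 - rho by rewrite /rho; lra.
  by rewrite /eta; nra.
have := ler_wpM2l (ltW ash) final; lra.
Qed.

End lyapunov_drift.

(** * Transience of a countable chain *)

Section transience.
Context {d : measure_display} {T : measurableType d} {R : realType}.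
Variables (P : probability T R) (U : countType).
Variables (Z : nat -> T -> U) (step : nat -> U -> T -> U) (H : nat -> set_system T).
Hypothesis ZS : forall n w, Z n.+1 w = step n (Z n w) w.
Hypothesis HS : forall n, sigma_algebra setT (H n).
Hypothesis Hm : forall n, H n `<=` measurable.
Hypothesis Hmono : forall n, H n `<=` H n.+1.
Hypothesis ZH : forall n, sigma_of (Z n) `<=` H n.
Hypothesis rstep : forall n z, random_element (step n z).
Hypothesis indep : forall n z A B, H n A ->
  P (A `&` step n z @^-1` B) = (P A * P (step n z @^-1` B))%E.
Variables (C : set U) (V gamma : U -> R) (vC : R).
Hypothesis V_ge0 : forall z, 0 <= V z.
Hypothesis V_le1 : forall z, V z <= 1.
Hypothesis gamma_ge0 : forall z, 0 <= gamma z.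
Hypothesis gamma_gt0 : forall z, C z -> 0 < gamma z.
Hypothesis drift : forall n z, C z ->
  (\int[P]_w (V (step n z w))%:E + (gamma z)%:E <= (V z)%:E)%E.
Hypothesis vC_le : forall z, ~ C z -> vC <= V z.
Variables (n0 : nat) (z0 : U).
Hypothesis Cz0 : C z0.
Hypothesis Vz0 : V z0 < vC.
Hypothesis z0_gt0 : (0 < P (Z n0 @^-1` [set z0]))%E.

Let rZ n : random_element (Z n).
Proof. exact: subset_trans (ZH (n := n)) (Hm (n := n)). Qed.

(** Integrating over these decreasing events does the work of a stopping time: the chain is killed
    when it leaves C. *)
Fixpoint staying k : set T :=
  if k is k'.+1 then staying k' `&` Z (n0 + k'.+1)%N @^-1` C
  else Z n0 @^-1` [set z0].

Lemma staying_C k w : staying k w -> C (Z (n0 + k)%N w).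
Proof. by case: k => [|k []//]; rewrite addn0 /= => ->. Qed.

Lemma staying_H k : H (n0 + k)%N (staying k).
Proof.
elim: k => [|k IH] /=.
  by rewrite addn0; move/sigma_ofP : (@ZH n0); exact.
apply: (sigma_setI (HS _)); first by rewrite addnS; exact: Hmono.
by move/sigma_ofP : (@ZH (n0 + k.+1)%N); exact.
Qed.

Lemma staying_measurable k : measurable (staying k).
Proof. exact: Hm (@staying_H k). Qed.

Let mV n (f : U -> \bar R) D : measurable_fun D (fun w => f (Z n w)).
Proof. exact: (@measurable_fun_countable _ _ U (Z n) _ _ f D (@rZ n)). Qed.

Lemma staying_drift k :
  (\int[P]_(w in staying k) (V (Z (n0 + k).+1 w))%:E +
   \int[P]_(w in staying k) (gamma (Z (n0 + k) w))%:E <=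
   \int[P]_(w in staying k) (V (Z (n0 + k) w))%:E)%E.
Proof.
set n := (n0 + k)%N; have mA := staying_measurable k.
have gV f : (forall z, 0 <= f z) -> forall z, (0 <= (f z)%:E)%E.
  by move=> f0 z; rewrite lee_fin.
rewrite (@ge0_integral_countable_partition _ _ _ P U (Z n))//; last 2 first.
- by move=> w; exact: gV.
- exact: (mV n.+1 (EFin \o V)).
rewrite (@ge0_integral_countable _ _ _ P U (Z n) (staying k) (EFin \o gamma))//.
rewrite (@ge0_integral_countable _ _ _ P U (Z n) (staying k) (EFin \o V))//.
rewrite -nneseriesD; last 2 first.
- move=> j _ _; case: (pickle_inv j) => // z.
  by apply: integral_ge0 => w _; exact: gV.
- by move=> j _ _; case: (pickle_inv j) => // z; rewrite mule_ge0//; exact: gV.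
apply: lee_nneseries => [j _ _|j _]; case: (pickle_inv j) => [z|]; rewrite ?adde0//.
  by rewrite adde_ge0//; [apply: integral_ge0 => w _|rewrite mule_ge0//]; exact: gV.
set D := staying k `&` _.
have HD : H n D.
  apply: (sigma_setI (HS n)); first exact: staying_H.
  by move/sigma_ofP : (@ZH n); exact.
have mD := Hm HD.
rewrite (_ : (\int[P]_(w in D) _)%E =
    (\int[P]_(w in D) (V (step n z w))%:E)%E); last first.
  by apply: eq_integral => w; rewrite inE => -[_ /= <-]; rewrite ZS.
rewrite (integral_independent (psi := EFin \o V) (rstep (n := n) (z := z)) mD)//;
  last by move=> B; exact: indep.
(* The drift is known only on C, but on [staying k] no other state occurs. *)
have [Cz|Cz] := pselect (C z); last first.
  rewrite (_ : D = set0) ?measure0 ?mul0e ?mule0 ?adde0//.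
  by rewrite -subset0 => w [/staying_C + /= Zw]; rewrite -/n Zw.
rewrite muleC -[X in (_ + X)%E]/((gamma z)%:E * P D)%E -muleDl ?fin_num_measure//.
- by rewrite lee_wpmul2r//; exact: drift.
- by rewrite ge0_adde_def// inE; [apply: integral_ge0 => w _|]; exact: gV.
Qed.

Let fin_stay (f : U -> R) k : (forall z, 0 <= f z) -> (forall z, C z -> f z <= 1) ->
  (\int[P]_(w in staying k) (f (Z (n0 + k) w))%:E \is a fin_num)%E /\
  (\int[P]_(w in staying k) (f (Z (n0 + k) w))%:E <= P (staying k))%E.
Proof.
move=> f0 f1; have mA := staying_measurable k.
suff h : (\int[P]_(w in staying k) (f (Z (n0 + k) w))%:E <= P (staying k))%E.
  split => //; rewrite ge0_fin_numE; last by apply: integral_ge0 => w _; rewrite lee_fin.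
  by rewrite (le_lt_trans h)// (le_lt_trans (probability_le1 _ _))// ltry.
rewrite -[leRHS]mul1e -integral_cst//; apply: ge0_le_integral => //.
- by move=> w _; rewrite lee_fin.
- exact: (mV _ (EFin \o f)).
- by move=> w /staying_C Cw; rewrite lee_fin f1.
Qed.

(** A consequence of the drift, as V takes values between 0 and 1; it makes the integrals behind [g]
    finite. *)
Lemma gamma_le1 z : C z -> gamma z <= 1.
Proof.
move=> Cz; have h : (0 <= \int[P]_w (V (step 0%N z w))%:E)%E.
  by apply: integral_ge0 => w _; rewrite lee_fin.
have := drift 0%N Cz; rewrite -lee_fin => /(le_trans _) h2.
apply: le_trans (_ : _ <= (V z)%:E)%E _; last by rewrite lee_fin.
by apply: h2; rewrite leeDr.
Qed.

Let a k := fine (\int[P]_(w in staying k) (V (Z (n0 + k) w))%:E)%E.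
Let g k := fine (\int[P]_(w in staying k) (gamma (Z (n0 + k) w))%:E)%E.
Let s k := fine (P (staying k)).

(** Optional stopping by hand: on the part of [staying k] that leaves C at the next generation V is
    at least vC, so the exits are worth at least [vC * (s k - s k.+1)]. Inserting this into
    [staying_drift] makes the sum telescope. *)
Lemma staying_telescope k : a k + vC * s 0 + \sum_(j < k) g j <= a 0 + vC * s k.
Proof.
have aE j : (\int[P]_(w in staying j) (V (Z (n0 + j) w))%:E)%E = (a j)%:E.
  by rewrite fineK//; have [] := fin_stay j V_ge0 (fun z _ => V_le1 z).
have gE j : (\int[P]_(w in staying j) (gamma (Z (n0 + j) w))%:E)%E = (g j)%:E.
  by rewrite fineK//; have [] := fin_stay j gamma_ge0 gamma_le1.
have sE j : P (staying j) = (s j)%:E.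
  by rewrite fineK// fin_num_measure//; exact: staying_measurable.
elim: k => [|k IH]; first by rewrite big_ord0 addr0.
rewrite big_ord_recr /=.
suff : a k.+1 + vC * s k + g k <= a k + vC * s k.+1 by move: IH; lra.
have mA := staying_measurable k; have mA' := staying_measurable k.+1.
have := staying_drift k; rewrite aE gE.
have dis : staying k = staying k.+1 `|` (staying k `\` staying k.+1).
  by rewrite setDUK//= => w [].
rewrite [X in (\int[P]_(w in X) _ + _)%E]dis ge0_integral_setU//; last 4 first.
- exact: measurableD.
- exact: (mV _ (EFin \o V)).
- by move=> w _; rewrite lee_fin.
- by apply/disj_setPS => w [Aw [_ nAw]].
rewrite -addnS aE.
have sD : P (staying k `\` staying k.+1) = (s k - s k.+1)%:E.
  have sub : staying k.+1 `<=` staying k by move=> w [].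
  rewrite measureD//; last by rewrite (le_lt_trans (probability_le1 _ _))// ltry.
  by rewrite setIidr// EFinB -!sE.
have low : ((vC * (s k - s k.+1))%:E <=
   \int[P]_(w in staying k `\` staying k.+1) (V (Z (n0 + k.+1)%N w))%:E)%E.
  rewrite EFinM -sD -integral_cst; last exact: measurableD.
  apply: ge0_le_integral => //.
  - exact: measurableD.
  - by move=> w _; rewrite lee_fin (le_trans (V_ge0 z0))// ltW.
  - exact: (mV _ (EFin \o V)).
  - move=> w [Aw nAw]; rewrite lee_fin vC_le// => Cw; apply: nAw; split => //.
move=> h; have : (((a k.+1)%:E + (vC * (s k - s k.+1))%:E) + (g k)%:E <= (a k)%:E)%E.
  by apply: le_trans h; rewrite leeD2r// leeD2l.
by rewrite -!EFinD lee_fin; lra.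
Qed.

Lemma staying_lower_bound : exists2 r : R, 0 < r & forall k, r <= s k.
Proof.
have vC0 : 0 < vC by exact: le_lt_trans Vz0.
(* What remains of [staying_telescope] after dropping [a k] and the sum, since
   [a 0 = V z0 * s 0]. *)
exists ((vC - V z0) * s 0 / vC).
  rewrite divr_gt0// mulr_gt0 ?subr_gt0// fine_gt0//=.
  by rewrite z0_gt0 (le_lt_trans (probability_le1 _ _)) ?ltry//; exact: (staying_measurable 0).
move=> k; rewrite ler_pdivrMr//; have := staying_telescope k.
have a0 : a 0 = V z0 * s 0.
  rewrite /a (eq_integral (fun=> (V z0)%:E)); last first.
    by move=> w; rewrite inE /= addn0 => ->.
  rewrite integral_cst ?fineM ?fin_num_measure//; exact: (staying_measurable 0).
have ak : 0 <= a k by rewrite fine_ge0// integral_ge0// => w _; rewrite lee_fin.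
have gk : 0 <= \sum_(j < k) g j.
  by rewrite sumr_ge0// => j _; rewrite fine_ge0// integral_ge0// => w _; rewrite lee_fin.
by rewrite a0; lra.
Qed.

(** Each visit to z spends [gamma z] from a total budget of at most [a 0 + vC]. Only the value at
    this one state matters, so gamma may tend to 0 at infinity. *)
Lemma visits_summable z : C z ->
  (\sum_(k <oo) P (staying k `&` Z (n0 + k)%N @^-1` [set z]) < +oo)%E.
Proof.
move=> Cz; have gz := gamma_gt0 Cz.
have vC0 : 0 < vC by exact: le_lt_trans Vz0.
pose D k := staying k `&` Z (n0 + k)%N @^-1` [set z].
have mD k : measurable (D k).
  apply: measurableI; first exact: staying_measurable.
  exact: random_element_preimage.
have s01 k : 0 <= s k <= 1.
  have mA := staying_measurable k.
  by rewrite fine_ge0//= -lee_fin fineK ?fin_num_measure// probability_le1.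
have gD k : ((gamma z)%:E * P (D k) <= (g k)%:E)%E.
  have [fg _] := fin_stay k gamma_ge0 gamma_le1.
  rewrite fineK// -integral_cst//.
  rewrite [leLHS](_ : _ = \int[P]_(w in D k) (gamma (Z (n0 + k) w))%:E)%E; last first.
    by apply: eq_integral => w; rewrite inE => -[_ /= ->].
  apply: ge0_subset_integral => //.
  - exact: staying_measurable.
  - exact: (mV _ (EFin \o gamma)).
  - by move=> w _; rewrite lee_fin.
  - by move=> w [].
apply: (@le_lt_trans _ _ ((a 0 + vC) / gamma z)%:E); last by rewrite ltry.
apply: lime_le; first by apply: is_cvg_nneseries => n _ _.
apply: nearW => k.
rewrite -(@lee_pmul2l _ (gamma z)%:E)// -EFinM mulrCA divff ?lt0r_neq0// mulr1.
rewrite ge0_sume_distrr// big_mkord.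
apply: (@le_trans _ _ (\sum_(j < k) (g j)%:E)%E); first by apply: lee_sum => j _; exact: gD.
rewrite sumEFin lee_fin; have := staying_telescope k.
have ak : 0 <= a k by rewrite fine_ge0// integral_ge0// => w _; rewrite lee_fin.
have /andP[_ sk] := s01 k; have /andP[s0 _] := s01 0%N.
have := mulr_ge0 (ltW vC0) s0; have : vC * s k <= vC by rewrite ler_piMr// ltW.
by lra.
Qed.

(** By Borel-Cantelli each state accounts for a null set of infinitely many visits; the union of
    these is null and is removed from the event of staying forever. *)
Theorem transient : exists G : set T, [/\ measurable G, (0 < P G)%E &
  forall w, G w -> forall z, exists m, forall j, (m <= j)%N -> Z j w <> z].
Proof.
pose N z := lim_sup_set (fun k => staying k `&` Z (n0 + k)%N @^-1` [set z]).
have mD k z : measurable (staying k `&` Z (n0 + k)%N @^-1` [set z]).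
  apply: measurableI; first exact: staying_measurable.
  exact: random_element_preimage.
have mN z : measurable (N z).
  apply: bigcap_measurable => // n _; apply: bigcup_measurable => j _; exact: mD.
have PN z : P (N z) = 0%E.
  have [Cz|nCz] := pselect (C z).
    by apply: lim_sup_set_cvg0 => //; exact: visits_summable.
  rewrite (_ : N z = set0) ?measure0// -subset0 => w /(_ 0%N Logic.I)[j _].
  by move=> -[/staying_C + /= Zw]; rewrite Zw.
pose NN := \bigcup_z N z.
have NNE : NN = \bigcup_k (if @pickle_inv U k is Some z then N z else set0).
  apply/seteqP; split=> [w [z _ Nz]|w [k _]].
    by exists (pickle z) => //; rewrite pickleK_inv.
  by case: (pickle_inv k) => // z Nz; exists z.
have mNN : measurable NN.
  by rewrite NNE; apply: bigcup_measurable => k _; case: (pickle_inv k).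
have PNN : P NN = 0%E.
  apply/negligibleP => //; rewrite NNE; apply: negligible_bigcup => k.
  case: (pickle_inv k) => [z|]; last exact: negligible_set0.
  by apply/negligibleP => //; exact: PN.
pose S := \bigcap_k staying k.
have mS : measurable S by apply: bigcap_measurable => // k _; exact: staying_measurable.
have [r r0 rs] := staying_lower_bound.
have PS : (r%:E <= P S)%E.
  have : P \o staying @ \oo --> P S.
    apply: nonincreasing_cvg_mu => //.
    - by rewrite (le_lt_trans (probability_le1 _ _)) ?ltry//; exact: (staying_measurable 0).
    - exact: staying_measurable.
    - by apply/nonincreasing_seqP => k; apply/subsetPset => w [].
  move=> /cvg_lim <-//; apply: lime_ge.
    apply: ereal_nonincreasing_is_cvgn => i j ij; apply: le_measure.
    - by rewrite inE; exact: staying_measurable.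
    - by rewrite inE; exact: staying_measurable.
    - by move: ij => /subnK <-; elim: (j - i)%N => [//|m IH] w; rewrite addSn => -[/IH].
  apply: nearW => k /=; have mA := staying_measurable k.
  by rewrite -[P (staying k)]fineK ?fin_num_measure// lee_fin; exact: rs.
exists (S `\` NN); split; first exact: measurableD.
  rewrite measureD//; last by rewrite (le_lt_trans (probability_le1 _ _))// ltry.
  rewrite [X in (_ - X)%E](_ : _ = 0%E) ?sube0; first exact: lt_le_trans PS.
  apply/eqP; rewrite eq_le measure_ge0 andbT -[leRHS]PNN; apply: le_measure;
  by rewrite ?inE//; exact: measurableI.
move=> w [Sw nNN] z; apply: contrapT => h; apply: nNN; exists z => // n _.
apply: contrapT => h2; apply: h; exists (n0 + n)%N => j nj Zj; apply: h2.
have n0j : (n0 <= j)%N by rewrite (leq_trans _ nj)// leq_addr.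
exists (j - n0)%N; first by rewrite /= leq_subRL.
by split; [exact: Sw|rewrite /= subnKC].
Qed.

End transience.

(** * Norms on column vectors *)

Section norms.
Context {R : realType} {p : nat}.
Variable N : 'cV[R]_p -> R.
Hypothesis N_norm : is_norm N.

Lemma is_norm0 : N 0 = 0.
Proof. by case: N_norm => _ NZ _; rewrite -(scale0r 0) NZ normr0 mul0r. Qed.

Lemma is_normN x : N (- x) = N x.
Proof. by case: N_norm => _ NZ _; rewrite -scaleN1r NZ normrN1 mul1r. Qed.

Lemma is_norm_ge0 x : 0 <= N x.
Proof.
case: N_norm => _ _ ND; have := ND x (- x).
by rewrite subrr is_norm0 is_normN; lra.
Qed.

Lemma is_norm_le_coord x : N x <= \sum_i `|x i 0| * N (delta_mx i 0).
Proof.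
case: N_norm => _ NZ ND.
have NS (f : 'I_p -> 'cV[R]_p) : N (\sum_i f i) <= \sum_i N (f i).
  elim/big_ind2 : _ => [|a b a' b' h h'|//]; first by rewrite is_norm0.
  by rewrite (le_trans (ND _ _))// lerD.
rewrite [x in N x]matrix_sum_delta.
under eq_bigr do rewrite big_ord1.
apply: (le_trans (NS _)); apply: ler_sum => i _.
by rewrite NZ ord1.
Qed.

(** Equivalence of norms by compactness: N is Lipschitz for the sup norm, so the image of the
    sup-norm unit sphere is compact and avoids 0, and c is the radius of a ball around 0 that it
    misses. The transposition fits [bounded_closed_compact], which concerns row vectors. *)
Lemma is_norm_lower : exists2 c : R, 0 < c & forall (x : 'cV[R]_p) i, c * `|x i 0| <= N x.
Proof.
case: (N_norm) => N0 NZ ND.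
pose f (y : 'rV[R]_p) := N y^T.
pose C := 1 + \sum_i N (delta_mx i 0).
have C0 : 0 < C by rewrite ltr_pwDl// sumr_ge0// => i _; exact: is_norm_ge0.
have fC y : f y <= C * `|y|.
  rewrite /f (le_trans (is_norm_le_coord _))//.
  rewrite mulrDl mul1r mulr_suml -[leLHS]add0r lerD// ler_sum// => i _.
  rewrite mulrC ler_wpM2l ?is_norm_ge0// mxE.
  rewrite [leRHS]/Num.norm /= mx_normrE; apply/bigmax_geP; right => /=.
  by exists (0, i).
have fd y y' : `|f y - f y'| <= C * `|y - y'|.
  apply: le_trans (fC _); rewrite /f ler_norml lerBrDr lerBlDr raddfB /=.
  apply/andP; split; rewrite addrC.
    rewrite lerBlDr -[N (_ - _)]is_normN opprB.
    by rewrite -{1}(subrK y^T y'^T) addrC ND.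
  by rewrite -{1}(subrK y'^T y^T) addrC ND.
have fc : continuous (f : 'rV[R]_p -> R^o).
  move=> y; apply/(@cvgrPdist_lt _ _ _ _ (nbhs_filter y)) => e e0.
  apply/nbhs_ballP; exists (e / C) => /=; first by rewrite divr_gt0.
  move=> y'; rewrite -ball_normE /ball_ /= => yy'.
  by rewrite (le_lt_trans (fd _ _))// -ltr_pdivlMl// mulrC.
pose S := [set y : 'rV[R]_p | `|y| = 1].
have Sc : compact S.
  apply: bounded_closed_compact.
    by exists 1; split => // t t1 y /= ->; exact: ltW.
  rewrite (_ : S = (fun y : 'rV[R]_p => `|y| : R^o) @^-1` [set 1]) //.
  apply: closed_comp; last exact: closed_eq.
  by move=> y _; exact: norm_continuous.
have fSc : closed (f @` S : set R^o).
  apply: compact_closed; first exact: Rhausdorff.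
  by apply: continuous_compact => //; exact: continuous_subspaceT.
have n0 : ~ (f @` S) 0.
  move=> [y /= y1] /N0 /(congr1 trmx); rewrite trmxK trmx0 => y0.
  suff : (1 : R) = 0 by move/eqP; rewrite oner_eq0.
  by rewrite -y1 y0; exact: normr0.
have : nbhs (0 : R^o) (~` (f @` S)).
  by apply: open_nbhs_nbhs; split => //; exact: closed_openC.
move=> /nbhs_ballP[c /= c0 cS]; exists c => // x i.
have [->|x0] := eqVneq (x i 0) 0; first by rewrite normr0 mulr0 is_norm_ge0.
pose y := x^T.
have yi : `|x i 0| <= `|y|.
  rewrite [leRHS]/Num.norm /= mx_normrE; apply/bigmax_geP; right => /=.
  by exists (0, i) => //; rewrite mxE.
have y0 : 0 < `|y| by apply: lt_le_trans yi; rewrite normr_gt0.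
have Sy : S (`|y|^-1 *: y).
  by rewrite /S /= normrZ normfV normr_id mulVf// lt0r_neq0.
have : c <= f (`|y|^-1 *: y).
  rewrite leNgt; apply/negP => fc'; apply: (cS (f (`|y|^-1 *: y))); last first.
    by exists (`|y|^-1 *: y).
  by rewrite -ball_normE /ball_ /= sub0r normrN ger0_norm// is_norm_ge0.
have -> : f (`|y|^-1 *: y) = `|y|^-1 * N x.
  rewrite /f (_ : _^T = `|y|^-1 *: x) ?NZ ?normfV ?normr_id//.
  by apply/matrixP => j k; rewrite !mxE.
move=> h.
by apply: (le_trans (ler_wpM2l (ltW c0) yi)); rewrite -ler_pdivlMr// mulrC.
Qed.

End norms.

(** * Reachability of large populations *)

Section positive_probability.
Context {d : measure_display} {T : measurableType d} {R : realType}.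
Variable P : probability T R.

Lemma positive_bigcup (I : countType) (D : set I) (F : I -> set T) :
  (forall i, measurable (F i)) -> (0 < P (\bigcup_(i in D) F i))%E ->
  exists2 i, D i & (0 < P (F i))%E.
Proof.
move=> mF Pgt0; apply: contrapT => h.
have PF i : D i -> P (F i) = 0%E.
  move=> Di; apply/eqP; rewrite eq_le measure_ge0 andbT leNgt; apply/negP => PFi.
  by apply: h; exists i.
have : P.-negligible (\bigcup_(i in D) F i).
  apply: (@negligibleS _ _ _ P (\bigcup_k
     (if @pickle_inv I k is Some i then if `[< D i >] then F i else set0
      else set0))).
    move=> w [i Di Fi]; exists (pickle i) => //; rewrite pickleK_inv.
    by case: asboolP.
  apply: negligible_bigcup => k; case: (pickle_inv k) => [i|]; last exact: negligible_set0.
  by case: asboolP => Di; [apply/negligibleP => //; exact: PF|exact: negligible_set0].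
move/negligibleP => P0; move: Pgt0; rewrite P0 ?ltxx//.
apply: (sigma_countable_bigcup (@sigma_algebra_measurable _ T)) => i; exact: mF.
Qed.

End positive_probability.

Section growth.
Context {d : measure_display} {T : measurableType d} {R : realType}.
Variables (P : probability T R) (p : nat).
Variables (Z0 : T -> 'cV[nat]_p) (X : nat -> nat -> 'I_p -> T -> 'cV[nat]_p)
  (Dm Im : nat -> 'cV[nat]_p -> T -> 'cV[nat]_p)
  (M : nat -> 'cV[nat]_p -> T -> 'cV[int]_p) (pz qz rz : 'cV[nat]_p -> 'I_p -> R).
Hypothesis model : is_mbpm P Z0 X Dm Im M pz qz rz.
Hypothesis growth : forall z : 'cV[nat]_p, z != 0 ->
  (0 < P [set w | forall i : 'I_p, (0 < z i 0%R)%N ->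
    [/\ M 0%N z w i 0%R = (Im 0%N z w i 0%R)%:Z,
        (0 < Im 0%N z w i 0%R)%N &
        forall j : nat, (j < z i 0%R + Im 0%N z w i 0%R)%N ->
          X 0%N j i w != 0]]%R)%E.

Local Notation Z := (mbpm Z0 X M).

Definition nonzero : set 'cV[nat]_p := [set x | x != 0].

(** Being integral, unlike the height, it rises by at least 1 whenever it increases, so finitely
    many growth steps reach any level. *)
Definition popsize (z : 'cV[nat]_p) : nat := \sum_(i < p) z i 0%R.

Lemma popsizeD a b : popsize (a + b) = (popsize a + popsize b)%N.
Proof. by rewrite /popsize -big_split; apply: eq_bigr => i _; rewrite mxE. Qed.

Lemma popsize_eq0 z : (popsize z == 0%N) = (z == 0).
Proof.
apply/eqP/eqP => [|->]; last by rewrite /popsize big1// => i _; rewrite mxE.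
move=> /eqP; rewrite sum_nat_eq0 => /forallP z0; apply/matrixP => i j.
by rewrite ord1 mxE; have /eqP := z0 i.
Qed.

(* The individuals of the types present in z, once the migration m has taken
   place: only these are known to have offspring. *)
Definition present (z : 'cV[nat]_p) (m : 'cV[int]_p) : 'cV[nat]_p :=
  \col_i (if (0 < z i 0%R)%N then reproducing z m i 0%R else 0%N).

Definition fertile n z m : set T :=
  M n z @^-1` [set m] `&` \bigcap_(k in [set` individuals (present z m)])
    X n k.1 k.2 @^-1` nonzero.

(** The growth condition concerns generation 0 only. Fixing the migration m makes the list of
    individuals deterministic, so [fertile] is a finite intersection of label events, and its
    probability is a product that depends on the laws alone. *)
Lemma fertile_prob n z m : P (fertile n z m) = P (fertile 0 z m).
Proof.
have main k : P (fertile k z m) = (P (M k z @^-1` [set m]) *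
    \prod_(l <- individuals (present z m)) P (X k l.1 l.2 @^-1` nonzero))%E.
  pose lab (l : nat * 'I_p) : mbpm_label p := inl (inr (k, l.1, l.2)).
  pose s := inr (k, z) :: [seq lab l | l <- individuals (present z m)].
  pose E (l : mbpm_label p) := match l with
    | inl (inr (k, j, i)) => X k j i @^-1` nonzero
    | inl (inl _) => setT
    | inr (k, z) => M k z @^-1` [set m] end.
  have -> : fertile k z m = \bigcap_(l in [set` s]) E l.
    apply/seteqP; split=> [w [Mw Xw] l /=|w h].
      by rewrite inE => /orP[/eqP -> //|/mapP[[j i] jis ->]]; exact: Xw.
    split; first by apply: (h (inr (k, z))); rewrite /= mem_head.
    move=> -[j i] /= jis; apply: (h (lab (j, i))).
    by rewrite /= inE; apply/orP; right; apply: map_f.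
  rewrite (mbpm_independent model); first by rewrite /s big_cons big_map.
    rewrite /s /=; apply/andP; split; first by apply/mapP => -[].
    rewrite map_inj_uniq ?individuals_uniq//.
    by move=> [j i] [j' i'] /= [-> ->].
  move=> [[[]|[[k' j] i]]|[k' z']] _ /=.
  - exact: sigma_ofT.
  - exact: sigma_of_preimage.
  - exact: sigma_of_preimage.
rewrite !main; congr (_ * _)%E; first exact: (mbpm_M_law model).
by apply: eq_bigr => l _; exact: (mbpm_X_law model).
Qed.

Lemma fertile_measurable n z m : measurable (fertile n z m).
Proof.
apply: measurableI.
  by apply: random_element_preimage; exact: (mbpm_M_random model).
rewrite bigcap_eq_seq; apply: big_ind => // [|k _]; first exact: measurableI.
by apply: random_element_preimage; exact: (mbpm_X_random model).
Qed.

Lemma popsize_sum_ge (I : Type) (r : seq I) (f : I -> 'cV[nat]_p) :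
  popsize (\sum_(i <- r) f i) = (\sum_(i <- r) popsize (f i))%N.
Proof.
elim: r => [|i r IH]; last by rewrite !big_cons popsizeD IH.
by rewrite !big_nil; apply/eqP; rewrite popsize_eq0.
Qed.

(** Immigration strictly enlarges every type present, and each of these individuals then has at
    least one child. Other types can only add to the count. *)
Lemma fertile_step n (z : 'cV[nat]_p) (m : 'cV[int]_p) w : z != 0 ->
  (forall i, (0 < z i 0%R)%N -> 0 < m i 0%R) -> fertile n z m w ->
  (popsize z < popsize (step X M n z w))%N.
Proof.
move=> z0 mpos [/= Mw Xw].
have le_total : (popsize z < popsize (present z m))%N.
  have [i zi] : exists i, (0 < z i 0%R)%N.
    apply/existsP; apply: contraT; rewrite negb_exists => /forallP h.
    case/negP: z0; rewrite -popsize_eq0 /popsize big1// => i _.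
    by apply/eqP; have := h i; rewrite -leqNgt leqn0.
  have pz' j : (z j 0%R + (0 < z j 0%R) <= present z m j 0%R)%N.
    rewrite mxE; case: ifPn => [zj|]; last by rewrite -leqNgt leqn0 => /eqP ->.
    by rewrite mxE; have := mpos j zj; lia.
  rewrite /popsize (bigD1 i)//= [X in (_ < X)%N](bigD1 i)//= -addSn leq_add//.
    by have := pz' i; rewrite zi; lia.
  by apply: leq_sum => j _; have := pz' j; lia.
apply: (leq_trans le_total).
rewrite /step Mw /popsum popsize_sum_ge /popsize leq_sum// => i _.
rewrite -/(popsize _) popsize_sum_ge mxE; case: ifPn => // zi.
rewrite -[X in (X <= _)%N]card_ord -sum1_card leq_sum// => j _.
rewrite lt0n popsize_eq0.
have h (k : nat) : (k < reproducing z m i 0%R)%N -> X n k i w != 0.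
  move=> kc; apply: (Xw (k, i)) => /=.
  apply/allpairsPdep; exists i, k; split => //; first by rewrite mem_enum.
  by rewrite mem_iota /= add0n mxE zi.
by apply: h; exact: ltn_ord.
Qed.

Let sM : sigma_algebra setT (@measurable _ T).
Proof. exact: sigma_algebra_measurable. Qed.

Lemma growth_fertile (z : 'cV[nat]_p) : z != 0 -> exists m : 'cV[int]_p,
  (forall i, (0 < z i 0%R)%N -> 0 < m i 0%R) /\ (0 < P (fertile 0 z m))%E.
Proof.
move=> z0; have := growth z0; set E := [set w | _] => PE.
have rM : random_element (M 0%N z) by exact: (mbpm_M_random model).
have rI : random_element (Im 0%N z) by exact: (mbpm_I_random model).
have rX j i : random_element (X 0%N j i) by exact: (mbpm_X_random model).
(* The number of conditions on the offspring is random; splitting over the value a of the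
   immigration vector makes it deterministic. *)
have mE : measurable E.
  rewrite (_ : E = \bigcup_a (Im 0%N z @^-1` [set a] `&`
    \bigcap_(i in [set i : 'I_p | (0 < z i 0%R)%N])
     (M 0%N z @^-1` [set m | m i 0%R = (a i 0%R)%:Z /\ (0 < a i 0%R)%N] `&`
      \bigcap_(j in [set j | (j < z i 0%R + a i 0%R)%N])
        X 0%N j i @^-1` nonzero))).
    apply: (sigma_countable_bigcup sM) => a; apply: measurableI.
      exact: random_element_preimage.
    apply: (sigma_countable_bigcap sM) => i; apply: measurableI.
      exact: random_element_preimage.
    by apply: (sigma_countable_bigcap sM) => j; exact: random_element_preimage.
  apply/seteqP; split=> [w Ew|w [a _ [/= Ia h]] i zi].
    exists (Im 0%N z w) => //; split => // i /= zi.
    by have [-> ? h] := Ew i zi; split.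
  by have [[Mi ai] h'] := h i zi; rewrite Ia; split.
pose D := [set m : 'cV[int]_p | forall i, (0 < z i 0%R)%N -> 0 < m i 0%R].
have [|m mpos Pm] := @positive_bigcup _ _ _ P 'cV[int]_p D (fertile 0 z)
  (fun m => fertile_measurable 0 z m).
  apply: (lt_le_trans PE); apply: le_measure; rewrite ?inE//.
    by apply: (sigma_countable_bigcup sM) => m; exact: fertile_measurable.
  move=> w Ew; exists (M 0%N z w); first by move=> i /Ew[-> ? _]; rewrite ltz_nat.
  split => // -[j i] /= /allpairsPdep[i' [j' [_ + /pair_equal_spec[-> ->]]]].
  rewrite mem_iota add0n /= mxE; case: ifPn => // zi.
  have [Mi _ h] := Ew _ zi; rewrite mxE Mi => jlt; apply: h.
  by move: jlt; lia.
by exists m.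
Qed.

Lemma growth_step n (z : 'cV[nat]_p) : z != 0 -> (0 < P (Z n @^-1` [set z]))%E ->
  exists z', (popsize z < popsize z')%N /\ (0 < P (Z n.+1 @^-1` [set z']))%E.
Proof.
move=> z0 Pz; have [m [mpos Pm]] := growth_fertile z0.
pose B := [set z' | (popsize z < popsize z')%N].
have rstep : random_element (step X M n z) by exact: (step_random model).
have PB : (0 < P (step X M n z @^-1` B))%E.
  rewrite -(fertile_prob n) in Pm; apply: (lt_le_trans Pm).
  apply: le_measure; rewrite ?inE//; first exact: fertile_measurable.
    exact: random_element_preimage.
  by move=> w; exact: fertile_step.
have rZ k : random_element (Z k) by exact: (mbpm_random model).
have mZ z' : measurable (Z n.+1 @^-1` [set z']) by exact: random_element_preimage.
have [|z' Bz' Pz'] := @positive_bigcup _ _ _ P 'cV[nat]_p B _ mZ.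
- have H : <<s cylinders (K := mbpm_label p) (mbpm_sigma Z0 X M) (past_labels (p := p) n) >>
      (Z n @^-1` [set z]).
    by move/sigma_ofP : (@mbpm_sigma_past _ _ p Z0 X M n); exact.
  have := past_step_independent model z B H.
  move=> PI; apply: (@lt_le_trans _ _ (P (Z n @^-1` [set z] `&` step X M n z @^-1` B))).
    by rewrite PI mule_gt0.
  apply: le_measure; rewrite ?inE//.
  + by apply: measurableI; exact: random_element_preimage.
  + by apply: (sigma_countable_bigcup sM) => z'; exact: random_element_preimage.
  move=> w [/= Zw Bw]; exists (Z n.+1 w) => //.
  by rewrite mbpmS Zw.
by exists z'.
Qed.

Lemma reach_high : (0 < P [set w | exists n, Z n w != 0]%R)%E ->
  forall L, exists n z, (L <= popsize z)%N /\ (0 < P (Z n @^-1` [set z]))%E.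
Proof.
move=> nonnull.
have rZ k : random_element (Z k) by exact: (mbpm_random model).
have mZ (nz : nat * 'cV[nat]_p) : measurable (Z nz.1 @^-1` [set nz.2]).
  exact: random_element_preimage.
have [|[n z] /= z0 Pz] := @positive_bigcup _ _ _ P (nat * 'cV[nat]_p)%type
    [set nz | nz.2 != 0] _ mZ.
- rewrite (_ : \bigcup_(i in _) _ = [set w | exists n, Z n w != 0])//.
  apply/seteqP; split=> [w [[n z] /= z0 Zw]|w [n Zw]].
    by exists n; rewrite Zw.
  by exists (n, Z n w).
elim=> [|L [m [y [Ly Py]]]]; first by exists n, z.
(* The null vector can only occur at level 0, and then the nonnull state z already serves for level
   1. *)
have [y0|y0] := eqVneq y 0.
  have L0 : L = 0%N by move: Ly; rewrite y0 (eqP (_ : popsize 0 == 0%N)) ?popsize_eq0//; lia.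
  by exists n, z; split => //; rewrite L0 lt0n popsize_eq0.
have [y' [yy' Py']] := growth_step y0 Py.
by exists m.+1, y'; split => //; exact: leq_ltn_trans yy'.
Qed.

End growth.

(** * Proof of the theorem *)

Section asymptotics.
Context {R : realType} {p : nat}.
Variables (u : 'cV[R]_p) (N : 'cV[R]_p -> R).
Hypothesis u_gt0 : forall i, 0 < u i 0.
Hypothesis u_sum : \sum_(i < p) u i 0 = 1.
Hypothesis N_norm : is_norm N.
Local Notation height := (height u).

Lemma height_le_norm : exists2 c, 0 < c & forall z, height z <= c * N (vec_nat z).
Proof.
have [c c0 cN] := is_norm_lower N_norm.
exists c^-1; first by rewrite invr_gt0.
move=> z; rewrite -[leRHS]mul1r -u_sum mulr_suml heightE ler_sum// => i _.
rewrite ler_pM2l// ler_pdivlMl//; have := cN (vec_nat z) i.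
by rewrite mxE ger0_norm.
Qed.

Lemma norm_le_height : exists2 c, 0 < c & forall z, N (vec_nat z) <= c * height z.
Proof.
have c0 : 0 <= \sum_i N (delta_mx i 0) / u i 0.
  by rewrite sumr_ge0// => i _; rewrite divr_ge0 ?(ltW (u_gt0 i))// (is_norm_ge0 N_norm).
exists (1 + \sum_i N (delta_mx i 0) / u i 0); first by rewrite ltr_pwDl.
move=> z; apply: (le_trans (is_norm_le_coord N_norm _)).
rewrite mulrDl mul1r mulr_suml -[leLHS]add0r lerD ?height_ge0// ler_sum// => i _.
rewrite mxE ger0_norm// mulrC -mulrA ler_wpM2l ?(is_norm_ge0 N_norm)//.
rewrite ler_pdivlMl// heightE (bigD1 i)//= lerDl sumr_ge0// => j _.
by rewrite mulr_ge0// ltW.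
Qed.

Lemma near_norm_height (Q : set 'cV[nat]_p) : norm_oo N Q ->
  exists K, forall z, K <= height z -> Q z.
Proof.
move=> [A _ AQ]; have [c c0 hN] := height_le_norm.
(* The extra 1 turns the weak inequality on the height into the strict one of [norm_oo]. *)
exists (c * (A + 1)) => z Kz; apply: AQ => /=.
by have := le_trans Kz (hN z); rewrite ler_pM2l//; lra.
Qed.

Lemma popsize_le_height : exists2 c, 0 < c & forall z, c * (popsize z)%:R <= height z.
Proof.
have u0 i : 0 <= u i 0 by exact: ltW.
have [c c0 cu] := gap_of_nonneg u0.
exists c => // z; rewrite heightE /popsize natr_sum mulr_sumr ler_sum// => i _.
rewrite ler_wpM2r//; have [ui|//] := cu i.
by have := u_gt0 i; rewrite ui ltxx.
Qed.

Lemma finite_height_le (L : R) : finite_set [set z | height z <= L].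
Proof.
have [c c0 cz] := popsize_le_height.
(* No coordinate exceeds the total size, which is at most [L / c], so the states embed in the
   vectors with entries in ['I_B.+1]. *)
pose B := Num.truncn (L / c).
apply: (@sub_finite_set _ _ ((fun x : 'cV['I_B.+1]_p => map_mx (@nat_of_ord _) x)
  @` setT)); last by apply: finite_image; exact: finite_finset.
move=> z /= zL; exists (map_mx inord z) => //.
apply/matrixP => i j; rewrite !mxE ord1 inordK//.
have : (z i 0%R)%:R <= L / c.
  rewrite ler_pdivlMr// mulrC; apply: le_trans zL; apply: le_trans (cz z).
  by rewrite ler_pM2l// ler_nat /popsize (bigD1 i)//= leq_addr.
have L0 : 0 <= L / c.
  by apply: divr_ge0 (ltW c0); apply: le_trans zL; exact: height_ge0.
by rewrite ltnS /B => h; rewrite truncn_ge_nat.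
Qed.

End asymptotics.

(** Where [den z] is 0 its inverse is +oo, and the quotient is +oo, 0 or -oo according to the sign
    of [num z]; exceeding c still forces [num z] to be positive. *)
Lemma limf_einf_gt1 {R : realType} (T : choiceType) (X : filteredType T)
    (F : set_system X) (num den : X -> R) : (forall z, 0 <= den z) ->
  (1 < limf_einf (fun z => (num z)%:E / (den z)%:E) F)%E ->
  exists2 c : R, 1 < c & exists2 Q, F Q &
    forall z, Q z -> 0 < num z /\ c * den z <= num z.
Proof.
move=> den0; rewrite limf_einfE => /ereal_sup_gt[_ [Q FQ <-] Q1].
have [c c1 cQ] : exists2 c : R, 1 < c & (c%:E <= ereal_inf
    [set (num z)%:E / (den z)%:E | z in Q])%E.
  move: Q1; case: (ereal_inf _) => [r| |]//.
    by rewrite lte_fin => r1; exists r.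
  by move=> _; exists 2; [rewrite ltr1n|rewrite leey].
exists c => //; exists Q => // z Qz.
have : (c%:E <= (num z)%:E / (den z)%:E)%E.
  by apply: (le_trans cQ); apply: ereal_inf_lbound; exists z.
have c0 : 0 < c by exact: lt_trans c1.
have [d0|d0] := eqVneq (den z) 0.
  rewrite d0 mulr0 inve0; case: (ltgtP (num z) 0) => [n0|n0 _|->].
  - by rewrite lt0_muley// lte_fin.
  - by split => //; exact: ltW.
  - by rewrite mul0e lee_fin leNgt c0.
have dp : 0 < den z by rewrite lt_neqAle eq_sym d0 den0.
rewrite inver (negbTE d0) -EFinM lee_fin ler_pdivlMr// => h; split => //.
by apply: lt_le_trans h; rewrite mulr_gt0.
Qed.

Theorem theorem2 (d : measure_display) (T : measurableType d) (R : realType)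
    (P : probability T R) (p : nat) (p_gt0 : (0 < p)%N)
    (N : 'cV[R]_p -> R) (N_norm : is_norm N)
    (Z0 : T -> 'cV[nat]_p)
    (X : nat -> nat -> 'I_p -> T -> 'cV[nat]_p)
    (Dm Im : nat -> 'cV[nat]_p -> T -> 'cV[nat]_p)
    (M : nat -> 'cV[nat]_p -> T -> 'cV[int]_p)
    (pz qz rz : 'cV[nat]_p -> 'I_p -> R)
    (model : is_mbpm P Z0 X Dm Im M pz qz rz)
    (X_L2 : forall i, square_integrable P (fun w => vec_nat (X 0%N 0%N i w)))
    (M_L2 : forall z, square_integrable P (fun w => vec_int (M 0%N z w)))
    (m_primitive : primitive_mx (offspring_mean P X))
    (m_critical : PF_eigenvalue (offspring_mean P X) 1)
    (u v : 'cV[R]_p)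
    (u_gt0 : forall i, 0 < u i 0) (v_gt0 : forall i, 0 < v i 0)
    (u_left : u^T *m offspring_mean P X = u^T)
    (v_right : offspring_mean P X *m v = v)
    (u_sum : \sum_(i < p) u i 0 = 1) (uv_dot : dot u v = 1)
    (h_littleo : forall i : 'I_p,
      (fun z => migration_mean P M z i 0%R : R^o)
        =o_ (norm_oo N) (fun z => N (vec_nat z) : R^o))
    (growth : forall z : 'cV[nat]_p, z != 0 ->
      (0 < P [set w | forall i : 'I_p, (0 < z i 0%R)%N ->
                [/\ M 0%N z w i 0%R = (Im 0%N z w i 0%R)%:Z,
                    (0 < Im 0%N z w i 0%R)%N &
                    forall j : nat, (j < z i 0%R + Im 0%N z w i 0%R)%N ->
                      X 0%N j i w != 0]]%R)%E)
    (nonnull : (0 < P [set w | exists n, mbpm Z0 X M n w != 0]%R)%E)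
    (liminf_gt1 :
      (1 < limf_einf
             (fun z => (2 * dot u (vec_nat z) * dot u (migration_mean P M z))%R%:E
                       / (sigma2 P X M u z)%:E)
             (norm_oo N))%E)
    (delta alpha : R) (delta_gt0 : 0 < delta) (delta_le1 : delta <= 1)
    (alpha_gt0 : 0 < alpha)
    (moment1 : forall i : 'I_p,
      elittleo (norm_oo N)
        (fun z => 'E_P[(fun w =>
           `|(z i 0%R)%:R + (M 0%N z w i 0%R)%:~R| `^ (1 + delta / 2))%R])%E
        (fun z => dot u (vec_nat z) `^ (1 + delta)
                  * dot u (migration_mean P M z)
                  / ln (dot u (vec_nat z)) `^ (1 + alpha)))
    (moment2 : forall i : 'I_p,
      elittleo (norm_oo N)
        (fun z => 'E_P[(fun w =>
           `|(M 0%N z w i 0%R)%:~R - migration_mean P M z i 0%R|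
             `^ (2 + delta))%R])%E
        (fun z => dot u (vec_nat z) `^ (1 + delta)
                  * dot u (migration_mean P M z)
                  / ln (dot u (vec_nat z)) `^ (1 + alpha))) :
  (0 < P [set w | (fun n => N (vec_nat (mbpm Z0 X M n w))) @ \oo --> +oo]%R)%E.

Proof.
have u0 : forall i, 0 <= u i 0 by move=> i; exact: ltW.
have [c1 c10 Nh] := norm_le_height u_gt0 N_norm.
have [c2 c20 hN] := height_le_norm u_gt0 u_sum N_norm.
have [c c_gt1 [Q FQ HQ]] := limf_einf_gt1
  (sigma2_ge0 model X_L2 M_L2 u_left) liminf_gt1.
have [KQ HKQ] := near_norm_height u_gt0 u_sum N_norm FQ.
have large : exists K, forall z, K <= height u z ->
    0 < dot u (migration_mean P M z) /\
    c * sigma2 P X M u z <= 2 * height u z * dot u (migration_mean P M z).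
  exists (Num.max KQ 1) => z; rewrite ge_max => /andP[/HKQ/HQ[h1 h2] z1].
  split => //; move: h1; rewrite -mulrA pmulr_rgt0//.
  by rewrite pmulr_rgt0// (lt_le_trans ltr01).
have small (e : R) : 0 < e -> exists K, forall z, K <= height u z ->
    forall i, `|migration_mean P M z i 0| <= e * height u z.
  move=> e0.
  have nearQ i : norm_oo N [set z | `|migration_mean P M z i 0| <= e * height u z].
    (* The norm is at most c1 times the height, hence the division by c1. *)
    have /eqoP/(_ (e / c1)) := h_littleo i; rewrite divr_gt0// => /(_ isT).
    apply: filterS => z /= /le_trans; apply.
    rewrite ger0_norm ?(is_norm_ge0 N_norm)// -mulrA ler_pM2l// ler_pdivrMl//.
  have [K HK] : exists K, forall z, K <= height u z ->
      forall i, i \in enum 'I_p -> `|migration_mean P M z i 0| <= e * height u z.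
    elim: (enum 'I_p) => [|i s [K HK]]; first by exists 0.
    have [K' HK'] := near_norm_height u_gt0 u_sum N_norm (nearQ i).
    exists (Num.max K K') => z; rewrite ge_max => /andP[/HK h /HK' h'] j.
    by rewrite inE => /predU1P[->|/h].
  by exists K => z /HK h i; apply: h; rewrite mem_enum.
have moment (e : R) : 0 < e -> exists K, forall z, K <= height u z -> forall i,
    (\int[P]_w (`|(M 0%N z w i 0%R)%:~R - migration_mean P M z i 0%R|
       `^ (2 + delta))%:E <=
    (e * (height u z `^ (1 + delta) * dot u (migration_mean P M z)
          / ln (height u z) `^ (1 + alpha)))%:E)%E.
  move=> e0; have [K0 HK0] := large.
  have [K HK] : exists K, forall z, K <= height u z ->
    forall i, i \in enum 'I_p ->
    (\int[P]_w (`|(M 0%N z w i 0%R)%:~R - migration_mean P M z i 0%R|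
       `^ (2 + delta))%:E <=
    (e * (height u z `^ (1 + delta) * dot u (migration_mean P M z)
          / ln (height u z) `^ (1 + alpha)))%:E)%E.
    elim: (enum 'I_p) => [|i s [K HK]]; first by exists 0.
    have [K' HK'] := near_norm_height u_gt0 u_sum N_norm (moment2 i e e0).
    (* Beyond K0 the drift is positive, which removes the absolute value from the bound in
       [elittleo]. *)
    exists (Num.max (Num.max K K') K0) => z.
    rewrite !ge_max => /andP[/andP[/HK h /HK' h'] /HK0[h0 _]] j.
    rewrite inE => /predU1P[->|/h//].
    move: h'; rewrite /= unlock => h'.
    apply: (le_trans (lee_abs _)); apply: (le_trans h').
    rewrite lee_fin ler_pM2l// ger0_norm// divr_ge0 ?powR_ge0//.
    by rewrite mulr_ge0 ?powR_ge0// ltW.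
  by exists K => z /HK h i; apply: h; rewrite mem_enum.
have [K [gamma [gamma_gt0 driftP]]] := drift p_gt0 model X_L2 M_L2 u_gt0 u_left
  u_sum alpha_gt0 delta_gt0 c_gt1 small large moment.
(* [lyap] is compared on nonnegative arguments only, so the level is made nonnegative. *)
pose K1 := Num.max K 0.
have K10 : 0 <= K1 by rewrite le_max lexx orbT.
have [c3 c30 th] := popsize_le_height u_gt0.
(* The successor makes the height of z0 strictly exceed K1, so that [lyap] at z0 lies strictly below
   its value at K1. *)
have [n0 [z0 [Lz0 Pz0]]] := reach_high model growth nonnull
  (Num.truncn (K1 / c3)).+1.
have Kz0 : K1 < height u z0.
  apply: lt_le_trans (th z0); rewrite -ltr_pdivrMl// mulrC.
  by apply: (lt_le_trans (truncnS_gt _)); rewrite ler_nat.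
pose S := [set z | K1 <= height u z].
have KS z : S z -> K <= height u z by rewrite /S /= ge_max => /andP[].
(* Outside S the height is below K1, so [lyap alpha K1] is a lower bound for [lyap] there. As gamma
   is known to be positive on S only, its maximum with 0 supplies a function that is nonnegative
   everywhere. *)
have [G [mG PG Gz]] : exists G : set T, [/\ measurable G, (0 < P G)%E &
    forall w, G w -> forall z, exists m, forall j, (m <= j)%N ->
      mbpm Z0 X M j w <> z].
  apply: (@transient _ _ _ P 'cV[nat]_p (mbpm Z0 X M) (step X M)
    (fun n => <<s cylinders (K := mbpm_label p) (mbpm_sigma Z0 X M)
      (past_labels (p := p) n) >>) _ _ _ _ _ _ _ S
    (fun z => lyap alpha (height u z)) (fun z => Num.max (gamma z) 0)
    (lyap alpha K1) _ _ _ _ _ _ n0 z0).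
  - by move=> n w; exact: mbpmS.
  - by move=> n; exact: sigma_cyl.
  - by move=> n; exact: (past_measurable model).
  - by move=> n; apply: cyl_mono; exact: past_mono.
  - by move=> n; exact: mbpm_sigma_past.
  - by move=> n z; exact: (step_random model).
  - by move=> n z A B; exact: (past_step_independent model).
  - by move=> z; rewrite powR_ge0.
  - by move=> z; apply: lyap_le1 => //; exact: height_ge0.
  - by move=> z; rewrite le_max lexx orbT.
  - by move=> z /KS /gamma_gt0 g0; rewrite lt_max g0.
  - move=> n z /KS Kz; rewrite (max_idPl _); first exact: driftP.
    by apply: ltW; exact: gamma_gt0.
  - move=> z /negP; rewrite -ltNge => /ltW zK.
    by apply: ler_lyap => //; exact: height_ge0.
  - exact: ltW.
  - exact: ltr_lyap.
  - exact: Pz0.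
set W := [set w | _].
have rZ n : random_element (mbpm Z0 X M n) by exact: (mbpm_random model).
have WE : W = \bigcap_(L : nat) \bigcup_(m : nat) \bigcap_(j in [set j | (m <= j)%N])
    mbpm Z0 X M j @^-1` [set z | L%:R < N (vec_nat z)].
  apply/seteqP; split=> [w /cvgryPgt Ww L _|w Ww].
    have [m _ mW] := Ww L%:R.
    by exists m => // j /= mj; exact: mW.
  apply/cvgryPgt => A.
  have [m _ mW] := Ww (Num.truncn A).+1 Logic.I.
  exists m => // j /= mj; apply: lt_trans (mW j mj).
  exact: truncnS_gt.
have mW : measurable W.
  have sM := @sigma_algebra_measurable _ T.
  rewrite WE; apply: (sigma_countable_bigcap sM) => L.
  apply: (sigma_countable_bigcup sM) => m; apply: (sigma_countable_bigcap sM) => j.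
  exact: random_element_preimage.
apply: (lt_le_trans PG); apply: le_measure; rewrite ?inE// => w Gw.
rewrite WE => L _.
(* A norm of at most L forces a height of at most [c2 * L%:R]; such states are finitely many, and on
   G each is avoided from some time on. *)
have /finite_seqP[s sE] := finite_height_le u_gt0 (c2 * L%:R).
have [m mP] : exists m, forall j, (m <= j)%N ->
    forall z, z \in s -> mbpm Z0 X M j w <> z.
  elim: s {sE} => [|z s [m mP]]; first by exists 0%N.
  have [m' mP'] := Gz w Gw z.
  exists (maxn m m') => j; rewrite geq_max => /andP[mj mj'] y.
  by rewrite inE => /predU1P[->|ys]; [exact: mP'|exact: mP].
exists m => // j /= mj; rewrite ltNge; apply/negP => NL.
have : [set z | height u z <= c2 * L%:R] (mbpm Z0 X M j w).
  by rewrite /= (le_trans (hN _))// ler_pM2l.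
by rewrite sE /= => /(mP j mj).
Qed.
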